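(* Let $\alpha,\beta$ be integers different from $1$ with $v_2(\alpha-1)=v_2(\beta-1)=m\ge 3$, and let $\ell=v_2(\alpha-\beta)$ satisfy $m<\ell\le 2m-3$ and $2\ell+2>3m+1$. Then $|G_2|=2^{5m+\ell-1}$, the nilpotency class of $G_2$ is $5$, $o(a)=o(b)=2^{\ell+m+1}$ and $o(c)=2^{2m}$.
   Context: $G(\alpha,\beta)=\langle A,B\mid A^{[A,B]}=A^{\alpha},\ B^{[B,A]}=B^{\beta}\rangle$ with $[x,y]=x^{-1}y^{-1}xy$, $y^x=x^{-1}yx$, and $C=[A,B]$. The group $G(\alpha,\beta)$ is finite and nilpotent, hence the direct product of its Sylow subgroups; $G_2$ denotes its Sylow $2$-subgroup and $a,b,c$ denote the images of $A,B,C$ under the canonical projection $G(\alpha,\beta)\to G_2$. $v_2$ is the $2$-adic valuation and $o(x)$ the order of $x$. *)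

(* Defs.v *)
From mathcomp Require Import all_boot all_order all_algebra all_fingroup all_solvable.
Set Implicit Arguments. Unset Strict Implicit. Unset Printing Implicit Defensive.
Import GRing.Theory.

Local Open Scope group_scope.

Definition zexpg (gT : finGroupType) (x : gT) (z : int) : gT :=
  match z with
  | Posz n => x ^+ n
  | Negz n => (x ^+ n.+1)^-1
  end.

(* The defining relations of G(al,be):
   A^[A,B] = A^al  and  B^[B,A] = B^be,
   with [x,y] = x^-1 y^-1 x y and y^x = x^-1 y x (MathComp conventions agree). *)
Definition Grels (gT : finGroupType) (al be : int) (A B : gT) : Prop :=
  A ^ [~ A, B] = zexpg A al /\ B ^ [~ B, A] = zexpg B be.

(* G (a subgroup of gT) with elements A, B is (isomorphic to) the finitely
   presented group G(al,be) = < A, B | relations >: it is generated by A, B,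
   satisfies the relations, and maps onto every finite group generated by a
   pair satisfying the relations (universal property among finite groups,
   which characterizes G(al,be) up to isomorphism since G(al,be) is finite). *)
Definition presents_G (gT : finGroupType) (G : {group gT}) (al be : int)
    (A B : gT) : Prop :=
  [/\ G :=: <<[set A; B]>>, Grels al be A B &
      forall (hT : finGroupType) (x y : hT), Grels al be x y ->
        exists f : {morphism G >-> hT}, f A = x /\ f B = y].

(* Main.v *)
(* Finite groups satisfying the relations are nilpotent.  If the centre is
   trivial, then C acts faithfully by powers on <A> and <B>, so o(C) divides
   lcm(phi(o(A)), phi(o(B))); on the other hand <A^o(C)> is normalised by B and
   centralised by C, which forces the p-part of o(A) (and likewise o(B)) to
   divide o(C).  For the largest prime p dividing o(A)o(B) this is absurd.

   Upper bounds in G_2.  Computing a^(b^beta * c) in two ways gives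
   c^(alpha-beta) = b^W a^U with U, W odd multiples of 2^(2m-1).  Conjugation by
   this a^U maps b^(T+1) to b for an explicit T, so that c^U a^S = b^T; the
   symmetric relation holds too, and solving these relations in the abelian
   group <a^(2^(2m-1)), b^(2^(2m-1))> gives a^(2^(l+m+1)) = b^(2^(l+m+1)) = 1
   and c^(2^(2m-1)) \in <b>.  As G_2 = <b><c><a>, the order bound follows.

   Lower bounds.  On words b^j c^k a^i, right multiplication by a and b acts by
   (j,k,i) |-> (j,k,i+1) and
   (j,k,i) |-> (j + beta^k, k + i, alpha + ... + alpha^i).  Both maps descend to
   the quotient of Z^3 by an explicit lattice of index 2^(5m+l-1), and the
   permutations they induce satisfy the relations and generate a transitive
   group.

   Throughout, K = 2^s and D = 2^t with s = 2m-3-l and t = 2l-3m+2, so that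
   h = 2^(m-1) = 8 K^2 D, n1 = 2^l = 32 K^3 D^2 and
   2^(l+m+1) = 1024 K^5 D^3. *)
Require Import Defs.
From mathcomp Require Import all_boot all_order all_algebra all_fingroup all_solvable.
From mathcomp Require Import zify ring.
Import GRing.Theory.
Set Implicit Arguments. Unset Strict Implicit. Unset Printing Implicit Defensive.
Local Open Scope nat_scope.

(** * Geometric sums *)

Definition gsum (x n : nat) : nat := \sum_(i < n) x ^ i.

Lemma gsum0 x : gsum x 0 = 0. Proof. by rewrite /gsum big_ord0. Qed.

Lemma gsumSr x n : gsum x n.+1 = gsum x n + x ^ n.
Proof. by rewrite /gsum big_ord_recr. Qed.

Lemma gsumD x m n : gsum x (m + n) = gsum x m + x ^ m * gsum x n.
Proof.
elim: n => [|n IH]; first by rewrite gsum0 muln0 !addn0.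
by rewrite addnS !gsumSr IH expnD; ring.
Qed.

Lemma gsum1 x : gsum x 1 = 1. Proof. by rewrite gsumSr gsum0. Qed.

Lemma gsumS x n : gsum x n.+1 = 1 + x * gsum x n.
Proof. by rewrite -add1n gsumD gsum1 expn1. Qed.

Lemma gsumM x m n : gsum x (m * n) = gsum x m * gsum (x ^ m) n.
Proof.
elim: n => [|n IH]; first by rewrite muln0 !gsum0 muln0.
by rewrite mulnS addnC gsumD IH gsumSr expnM; ring.
Qed.

Lemma expn_gsum d n : d.+1 ^ n = 1 + d * gsum d.+1 n.
Proof.
elim: n => [|n IH]; first by rewrite gsum0 muln0.
by rewrite gsumSr mulnDr addnA -IH expnS mulSn addnC addnC.
Qed.

Lemma expn_binomial2 d n : exists q, d.+1 ^ n = 1 + n * d + d ^ 2 * q.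
Proof.
elim: n => [|n [q IH]]; first by exists 0; rewrite muln0.
by exists (q * d.+1 + n); rewrite expnS IH; ring.
Qed.

Lemma gsum_binomial2 d n : exists q, gsum d.+1 n = n + d * 'C(n, 2) + d ^ 2 * q.
Proof.
elim: n => [|n [q IH]]; first by exists 0; rewrite gsum0 !muln0.
have [r Er] := expn_binomial2 d n.
by exists (q + r); rewrite gsumSr IH Er binS bin1; ring.
Qed.

(** In [gsum_binomial2] the term [d * 'C(p, 2)] is divisible by [p ^ 2]: an odd [p] divides both
    factors, and for [p = 2] the binomial is 1 and [4 %| d]. *)
Lemma gsum_prime p d : prime p -> p %| d -> (p = 2 -> 4 %| d) ->
  exists q, gsum d.+1 p = p + p ^ 2 * q.
Proof.
move=> pp pd p2; have [q ->] := gsum_binomial2 d p.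
have : p ^ 2 %| d * 'C(p, 2) + d ^ 2 * q.
  apply: dvdn_add; last by apply: dvdn_mulr; apply: dvdn_exp2r.
  case: (eqVneq p 2) => [p_2|pn2].
    by rewrite [in 'C(_, _)]p_2 muln1 [X in X ^ 2]p_2; apply: p2.
  rewrite -mulnn; apply: dvdn_mul => //.
  by rewrite prime_dvd_bin //= ltn_neqAle eq_sym pn2 prime_gt1.
by case/dvdnP=> r Er; exists r; rewrite -addnA Er mulnC.
Qed.

(** Lifting the exponent, by induction on [v]: split off [gsum x p]; the new base [x ^ p] is again 1
    plus a multiple of [d], so the hypotheses persist. *)
Lemma gsum_lift p d v n : prime p -> p %| d -> (p = 2 -> 4 %| d) ->
  p ^ v %| n -> exists q, gsum d.+1 n = n + p ^ v.+1 * q.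
Proof.
move=> pp; elim: v d n => [|v IH] d n pd p2.
  move=> _; have [q ->] := gsum_binomial2 d n; case/dvdnP: pd => r ->.
  by exists (r * 'C(n, 2) + r ^ 2 * p * q); ring.
case/dvdnP=> k ->; rewrite [X in k * X]expnS mulnCA gsumM expn_gsum add1n.
have [q Eq] := gsum_prime pp pd p2.
have [|| r Er] := IH (d * gsum d.+1 p) (k * p ^ v) _ _ (dvdn_mull _ (dvdnn _)).
- exact: dvdn_mulr.
- by move=> p_2; apply: dvdn_mulr; apply: p2.
exists (q * k + q * p * r + r).
by rewrite [X in X * _]Eq Er !expnS; ring.
Qed.

Local Open Scope group_scope.

(** * Nilpotency *)

(** Natural exponents give access to the expansions of [gsum]; [Grels_macdonald] reduces integer
    exponents to this form modulo the element orders. *)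
Definition macdonald (gT : finGroupType) (x y : nat) (a b : gT) : Prop :=
  a ^ [~ a, b] = a ^+ x /\ b ^ [~ b, a] = b ^+ y.

Lemma macdonald_sym (gT : finGroupType) x y (a b : gT) :
  macdonald x y a b -> macdonald y x b a.
Proof. by case. Qed.

Lemma expgJ_comm (gT : finGroupType) x (a c : gT) n :
  a ^ c = a ^+ x -> a ^+ n * c = c * a ^+ (x * n).
Proof. by move=> ac; rewrite expgM -ac -conjXg conjgE !mulgA mulgV mul1g. Qed.

Lemma expgM_conj (gT : finGroupType) x (a c : gT) n :
  a ^ c = a ^+ x -> (a * c) ^+ n = c ^+ n * a ^+ (x * gsum x n).
Proof.
move=> ac; elim: n => [|n IH]; first by rewrite gsum0 muln0 !expg0 mulg1.
rewrite expgSr IH -mulgA [a ^+ _ * _]mulgA -expgSr.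
rewrite (expgJ_comm _ ac) mulgA -expgSr; congr (_ * _ ^+ _).
by rewrite gsumS; lia.
Qed.

Lemma expgJ_pow (gT : finGroupType) x (a c : gT) n :
  a ^ c = a ^+ x -> a ^ (c ^+ n) = a ^+ (x ^ n).
Proof.
move=> ac; elim: n => [|n IH]; first by rewrite conjg1.
by rewrite expgSr conjgM IH conjXg ac -expgM expnS.
Qed.

(** Since [a ^ b = a * [~ a, b]], this collects the n-th power of that product. It is the source of
    the exponents [x * gsum x n] below. *)
Lemma macdonald_conj (gT : finGroupType) x y (a b : gT) n :
  macdonald x y a b -> (a ^+ n) ^ b = [~ a, b] ^+ n * a ^+ (x * gsum x n).
Proof. by case=> ac _; rewrite conjXg conjg_mulR (expgM_conj _ ac). Qed.

Lemma coprime_order_conj (gT : finGroupType) x (a c : gT) :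
  a ^ c = a ^+ x -> coprime x #[a].
Proof.
move=> ac; have := orderJ a c; rewrite ac => oa.
rewrite coprime_sym; have: generator <[a]> (a ^+ x).
  rewrite /generator eq_sym -/(#[_]) eqEcard cycleX /=.
  by rewrite -!orderE oa.
by rewrite generator_coprime.
Qed.

(** A nontrivial [p]-part [p ^ e] has totient [p ^ (e - 1) * (p - 1)]. Any other prime [q] dividing
    [n] is smaller than [p], so [p] divides neither [q - 1] nor a power of [q]. *)
Lemma logn_totient p n : prime p -> (0 < n)%N ->
  (forall q, prime q -> q %| n -> q <= p)%N -> logn p (totient n) = (logn p n).-1.
Proof.
move=> pp n0 maxp; have [m cpm En] := pfactor_coprime pp n0.
have m0 : (0 < m)%N by move: n0; rewrite En; case: (m).
have cop : coprime p (totient m).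
  rewrite totientE // big_seq; elim/big_rec: _ => [|q x]; first exact: coprimen1.
  rewrite mem_primes => /and3P[pq _ qm] cx; rewrite coprimeMr cx andbT.
  have qp : q != p.
    by apply: contraTneq cpm => <-; rewrite prime_coprime // qm.
  have ltqp : (q < p)%N.
    by rewrite ltn_neqAle qp maxp // En dvdn_mulr.
  rewrite coprimeMr; apply/andP; split; last first.
    by apply: coprimeXr; rewrite prime_coprime // dvdn_prime2 // eq_sym.
  rewrite prime_coprime // gtnNdvd //; have := prime_gt1 pq; lia.
have logm : logn p (totient m) = 0%N.
  by rewrite lognE; case: and3P => // [[_ _]]; move: cop; rewrite prime_coprime // => /negPf->.
have [e0|e0] := posnP (logn p n).
  by rewrite e0 En e0 muln1 logm.
rewrite [in LHS]En totient_coprime; last by rewrite coprime_sym coprimeXl.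
have [p0 pm0] : (0 < p)%N /\ (0 < p.-1)%N by have := prime_gt1 pp; lia.
rewrite totient_pfactor // lognM ?totient_gt0 ?muln_gt0 ?pm0 ?expn_gt0 ?p0 //.
rewrite logm lognM ?expn_gt0 ?p0 // pfactorK //.
by rewrite lognE gtnNdvd ?andbF //; lia.
Qed.

Lemma commute_of_conj (gT : finGroupType) (z t : gT) : t ^ z = t -> commute z t.
Proof. by move=> tz; apply: commute_sym; rewrite /commute conjgC tz. Qed.

Section TrivialCenter.

Variables (gT : finGroupType) (G : {group gT}) (x y : nat) (a b : gT).
Hypothesis defG : G :=: <<[set a; b]>>.
Hypothesis rel : macdonald x y a b.
Hypothesis Z1 : 'Z(G) = 1.

Let c := [~ a, b].

Lemma gen2_center z : z \in G -> commute z a -> commute z b -> z = 1.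
Proof.
move=> zG za zb; apply/set1gP; rewrite -Z1 /center inE zG defG cent_gen.
by apply/centP=> t; rewrite !inE => /orP[] /eqP->.
Qed.

Lemma gen2_mem : a \in G /\ b \in G.
Proof. by rewrite defG; split; apply: mem_gen; rewrite !inE eqxx ?orbT. Qed.

Lemma comm_order_dvd n : x ^ n = 1 %[mod #[a]] -> y ^ n = 1 %[mod #[b]] ->
  #[c] %| n.
Proof.
move=> xn yn; have [aG bG] := gen2_mem; have [ac bc] := rel.
rewrite order_dvdn; apply/eqP/gen2_center.
- by rewrite groupX // groupR.
- apply: commute_of_conj; rewrite (expgJ_pow _ ac).
  by apply/eqP; rewrite -[X in _ == X]expg1 eq_expg_mod_order xn.
rewrite -[c ^+ n]invgK; apply/commute_sym/commuteV/commute_sym.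
apply: commute_of_conj; rewrite -expVgn invgR (expgJ_pow _ bc).
by apply/eqP; rewrite -[X in _ == X]expg1 eq_expg_mod_order yn.
Qed.

(** Conjugation by [b] sends [a ^+ k] to a power of [a] of the same order, so [b] normalises [H] and
    its centraliser. The latter contains [a], hence [a ^ b], hence [c]. *)
Lemma comm_fix : (a ^+ #[c]) ^ c = a ^+ #[c].
Proof.
set k := #[c]; set H := <[a ^+ k]>.
have zb : (a ^+ k) ^ b = a ^+ (x * gsum x k).
  by rewrite (macdonald_conj _ rel) expg_order mul1g.
have bN : b \in 'N(H).
  apply/normP/eqP; rewrite -cycleJ zb.
  rewrite (eq_subG_cyclic (cycle_cyclic a)) ?cycleX //.
  by rewrite -zb -!orderE orderJ.
have aC : a \in 'C(H).
  by rewrite cent_cycle; apply/cent1P/commuteX.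
suff : c \in 'C(H).
  by rewrite cent_cycle => /cent1P ckc; apply/conjg_fixP/commgP.
rewrite /c commgEl; apply: groupM; first by rewrite groupV.
by have: a ^ b \in 'C(H :^ b); [rewrite centJ memJ_conjg | rewrite (normP bN)].
Qed.

(** If [p] does not divide [d], [comm_fix] suffices. Otherwise, were [p ^ e] not to divide [#[c]],
    some power [z] of [a ^+ #[c]] would have order [p], and the expansion of [gsum] would make [z]
    commute with [b]: a nontrivial central element. *)
Lemma comm_order_part p d : prime p -> x = d.+1 -> 4 %| d ->
  p ^ logn p #[a] %| #[c].
Proof.
move=> pp xd d4; have [->|e0] := posnP (logn p #[a]); first exact: dvd1n.
set e := logn p #[a] in e0 *; set k := #[c].
have [aG bG] := gen2_mem; have [ac _] := rel.
have a0 : 0 < #[a] := order_gt0 a.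
have pea : p ^ e %| #[a] by exact: pfactor_dvdnn.
have adk : #[a] %| d * k.
  have := comm_fix; rewrite conjXg ac -expgM => /eqP.
  by rewrite eq_expg_mod_order xd mulSn -[X in _ == X %[mod _]]addn0 eqn_modDl mod0n.
case: (boolP (p %| d)) => [pd|npd]; last first.
  by rewrite -(@Gauss_dvdr _ d) ?(dvdn_trans pea) // coprimeXl // prime_coprime.
apply: contraT => npk.
have po : p %| #[a ^+ k].
  apply: contraR npk => npo.
  have : p ^ e %| #[a ^+ k] * gcdn #[a] k.
    by rewrite orderXgcd divnK ?dvdn_gcdl.
  rewrite Gauss_dvdr ?coprimeXl ?prime_coprime // => /dvdn_trans; apply.
  exact: dvdn_gcdr.
have [t ot] := dvdnP po; set z := a ^+ (k * t).
have oz : #[z] = p.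
  rewrite /z expgM orderXdiv ot ?dvdn_mulr // mulKn //.
  by have := order_gt0 (a ^+ k); rewrite ot; case: (t).
have akt : #[a] %| p * (k * t).
  by rewrite order_dvdn mulnC expgM -[X in _ ^+ X]oz expg_order.
have pkt : p ^ e.-1 %| k * t.
  rewrite -(@dvdn_pmul2l p) ?prime_gt0 // -expnS prednK //.
  exact: dvdn_trans akt.
have zb : z ^ b = a ^+ (x * gsum x (k * t)).
  by rewrite (macdonald_conj _ rel) expgM expg_order expg1n mul1g.
have p2 : p = 2 -> 4 %| d by [].
have [q Eq] := gsum_lift pp pd p2 pkt.
have azb : #[a] %| p * (x * gsum x (k * t)).
  by rewrite order_dvdn mulnC expgM -zb -conjXg -[X in _ ^+ X]oz expg_order conj1g.
(* This divisibility says that [z ^ b = z]. Its [p]-part comes from [p %| d] and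
   [p ^ e.-1 %| gsum x (k * t)], its prime-to-[p] part from the triviality of the [p]-th powers of
   [z] and [z ^ b]. *)
have : #[a] %| d * gsum x (k * t) + p ^ e * q.
  have pe : p ^ e %| d * gsum x (k * t) + p ^ e * q.
    apply: dvdn_add; last exact: dvdn_mulr.
    rewrite -{1}(prednK e0) expnS; apply: dvdn_mul => //.
    by rewrite xd Eq dvdn_add // expnS mulnAC dvdn_mull.
  have [n cpn En] := pfactor_coprime pp a0.
  rewrite En Gauss_dvd 1?coprime_sym ?coprimeXl // pe andbT.
  rewrite -(@Gauss_dvdr _ p) 1?coprime_sym //.
  have na : n %| #[a] by rewrite En dvdn_mulr.
  have nkt : n %| p * (k * t) := dvdn_trans na akt.
  have : n %| p * (d * gsum x (k * t) + p ^ e * q) + p * (k * t).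
    have -> : (p * (d * gsum x (k * t) + p ^ e * q) + p * (k * t))%N
              = (p * (x * gsum x (k * t)))%N.
      by rewrite xd Eq prednK //; ring.
    exact: dvdn_trans na azb.
  by rewrite dvdn_addl.
move=> adiff; have zbz : z ^ b = z.
  apply/eqP; rewrite zb eq_expg_mod_order xd mulSn {1}Eq prednK //.
  by rewrite -[X in _ == X %[mod _]]addn0 -addnA eqn_modDl mod0n addnC -xd.
have : z = 1.
  apply: gen2_center; first by rewrite groupX.
    exact/commute_sym/commuteX.
  exact/commute_sym/commute_of_conj.
by move/eqP; rewrite -order_eq1 oz; case: (p) pp => [|[]].
Qed.

End TrivialCenter.

Lemma macdonald_center1 (gT : finGroupType) (G : {group gT}) d e (a b : gT) :
  G :=: <<[set a; b]>> -> macdonald d.+1 e.+1 a b -> 4 %| d -> 4 %| e ->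
  'Z(G) = 1 -> G :=: 1.
Proof.
move=> defG rel d4 e4 Z1; have relV := macdonald_sym rel.
have defG' : G :=: <<[set b; a]>> by rewrite setUC.
have [a0 b0] : 0 < #[a] /\ 0 < #[b] by rewrite !order_gt0.
case: (ltnP 1 (#[a] * #[b])) => [ab1|]; last first.
  rewrite leqNgt; case: (eqVneq a 1) => [a1|na]; last first.
    by rewrite -order_gt1 in na; rewrite (leq_trans na) // leq_pmulr.
  rewrite a1 order1 mul1n order_gt1 negbK => /eqP b1.
  by apply/trivgP; rewrite defG a1 b1 gen_subG setUid.
have pp := max_pdiv_prime ab1; set p := max_pdiv _ in pp.
have maxp q : prime q -> q %| #[a] * #[b] -> q <= p.
  by move=> pq qab; apply: max_pdiv_max; rewrite mem_primes pq muln_gt0 a0 b0.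
have pa := comm_order_part defG rel Z1 pp erefl d4.
have pb := comm_order_part defG' relV Z1 pp erefl e4.
rewrite -invgR orderV in pb.
set L := lcmn (totient #[a]) (totient #[b]).
have L0 : 0 < L by rewrite lcmn_gt0 !totient_gt0 a0.
have cL : #[ [~ a, b] ] %| L.
  have expL w n : 0 < n -> coprime w n -> totient n %| L -> w ^ L = 1 %[mod n].
    move=> n0 cwn /dvdnP[k ->]; rewrite mulnC expnM.
    by rewrite -modnXm (Euler_exp_totient cwn) modnXm exp1n.
  have [ac bc] := rel.
  apply: (comm_order_dvd defG rel Z1); apply: expL => //.
  - exact: coprime_order_conj ac.
  - exact: dvdn_lcml.
  - exact: coprime_order_conj bc.
  exact: dvdn_lcmr.
move: (dvdn_trans pa cL) (dvdn_trans pb cL).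
rewrite !pfactor_dvdn // logn_lcm ?totient_gt0 //.
rewrite !logn_totient // => [|q pq qn|q pq qn]; last first.
- by apply: maxp => //; apply: dvdn_mulr.
- by apply: maxp => //; apply: dvdn_mull.
(* Both valuations are now at most the larger of their predecessors, so both vanish, against the
   choice of [p]. *)
have : 0 < logn p #[a] + logn p #[b].
  by rewrite -lognM // logn_gt0 pi_max_pdiv.
by rewrite !leq_max; lia.
Qed.

(** Induction on the order: a nontrivial centre is factored out, and the relations survive in the
    quotient. *)
Lemma macdonald_nilpotent (gT : finGroupType) (G : {group gT}) d e (a b : gT) :
  G :=: <<[set a; b]>> -> macdonald d.+1 e.+1 a b -> 4 %| d -> 4 %| e ->
  nilpotent G.
Proof.
move=> defG rel d4 e4; have [n] := ubnP #|G|.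
elim: n gT G a b defG rel => // n IH gT G a b defG rel ltGn.
case: (eqVneq 'Z(G) 1) => [Z1|nZ1].
  by rewrite (macdonald_center1 defG rel d4 e4 Z1) nilpotent1.
rewrite -quotient_center_nil.
have nZ : G \subset 'N('Z(G)) by apply: gFnorm.
have [aG bG] := gen2_mem defG.
have [aN bN] : a \in 'N('Z(G)) /\ b \in 'N('Z(G)) by rewrite !(subsetP nZ).
apply: (IH _ _ (coset 'Z(G) a) (coset 'Z(G) b)).
- have sabN : [set a; b] \subset 'N('Z(G)) by rewrite subUset !sub1set aN.
  by have := quotient_gen sabN; rewrite -defG quotientU !quotient_set1.
- have [ac bc] := rel.
  by split; rewrite -morphR // -morphJ ?groupR // ?ac ?bc morphX.
apply: leq_trans (ltn_quotient nZ1 _) _; first exact: center_sub.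
exact: ltGn.
Qed.

(** * Projection onto a Sylow subgroup *)

Lemma nilpotent_consttM (gT : finGroupType) (G : {group gT}) pi :
  nilpotent G -> {in G &, {morph constt^~ pi : x y / x * y}}.
Proof.
move=> nilG x y xG yG /=.
have [_ defG cPQ tiPQ] := dprodP (nilpotent_pcoreC pi nilG).
have hP := nilpotent_pcore_Hall pi nilG.
have hQ := nilpotent_pcore_Hall pi^' nilG.
have inP z : z \in G -> z.`_pi \in 'O_pi(G).
  by move=> zG; rewrite (mem_normal_Hall hP) ?pcore_normal ?p_elt_constt ?groupX.
have inQ z : z \in G -> z.`_pi^' \in 'O_pi^'(G).
  by move=> zG; rewrite (mem_normal_Hall hQ) ?pcore_normal ?p_elt_constt ?groupX.
have comPQ z t : z \in 'O_pi(G) -> t \in 'O_pi^'(G) -> commute z t.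
  by move=> zP tQ; apply: commute_sym; apply: (centsP cPQ).
have -> : x * y = (x.`_pi * y.`_pi) * (x.`_pi^' * y.`_pi^').
  rewrite -{1}(consttC pi x) -{1}(consttC pi y) !mulgA; congr (_ * _).
  by rewrite -!mulgA; congr (_ * _); apply/commute_sym/comPQ; [apply: inP|apply: inQ].
have xyP : x.`_pi * y.`_pi \in 'O_pi(G) by rewrite groupM ?inP.
have xyQ : x.`_pi^' * y.`_pi^' \in 'O_pi^'(G) by rewrite groupM ?inQ.
rewrite consttM; last exact: comPQ.
rewrite (constt_p_elt (mem_p_elt (pcore_pgroup _ _) xyP)).
suff -> : (x.`_pi^' * y.`_pi^').`_pi = 1 by rewrite mulg1.
apply/constt1P; exact: mem_p_elt (pcore_pgroup _ _) xyQ.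
Qed.

(** By [nilpotent_consttM], taking [p]-constituents is a morphism, the canonical projection of [G]
    onto its Sylow [p]-subgroup; it carries over generators, relations and commutator. *)
Lemma macdonald_sylow (gT : finGroupType) (G P : {group gT}) p d e (a b : gT) :
  G :=: <<[set a; b]>> -> macdonald d.+1 e.+1 a b -> 4 %| d -> 4 %| e ->
  P \in 'Syl_p(G) ->
  [/\ P :=: <<[set a.`_p; b.`_p]>>, macdonald d.+1 e.+1 a.`_p b.`_p &
      [~ a, b].`_p = [~ a.`_p, b.`_p]].
Proof.
move=> defG rel d4 e4; rewrite inE => sylP.
have nilG := macdonald_nilpotent defG rel d4 e4.
have defP : P :=: 'O_p(G) := nilpotent_Hall_pcore nilG sylP.
pose f := Morphism (nilpotent_consttM p nilG).
have fE x : f x = x.`_p by [].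
have [aG bG] := gen2_mem defG.
have fR : [~ a, b].`_p = [~ a.`_p, b.`_p] by rewrite -!fE morphR.
split=> //; last first.
  have [ac bc] := rel.
  by split; rewrite -!fE -morphR // -morphJ ?groupR // ?ac ?bc morphX.
have -> : P :=: f @* G.
  apply/eqP; rewrite eqEsubset; apply/andP; split.
    apply/subsetP=> z zP.
    have zG : z \in G by rewrite (subsetP (pHall_sub sylP)).
    have -> : z = f z.
      by rewrite fE constt_p_elt // (mem_p_elt (pHall_pgroup sylP)).
    exact: mem_morphim.
  apply/subsetP=> _ /morphimP[z zG _ ->]; rewrite fE defP.
  rewrite (mem_normal_Hall (nilpotent_pcore_Hall p nilG)) ?pcore_normal //.
    exact: p_elt_constt.
  by rewrite groupX.
have sabG : [set a; b] \subset G by rewrite subUset !sub1set aG.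
by have := morphim_gen f sabG; rewrite -defG morphimU !morphim_set1.
Qed.

Local Open Scope nat_scope.

(** * Binomial expansions modulo 2 h^3 *)

Lemma bin2D a b : 'C(a + b, 2) = 'C(a, 2) + a * b + 'C(b, 2).
Proof.
elim: b => [|b IH]; first by rewrite bin0n muln0 !addn0.
by rewrite addnS !binS IH !bin1; ring.
Qed.

Lemma bin3D a b : 'C(a + b, 3) = 'C(a, 3) + 'C(a, 2) * b + a * 'C(b, 2) + 'C(b, 3).
Proof.
elim: b => [|b IH]; first by rewrite !bin0n !muln0 !addn0.
by rewrite addnS !(binS _ 2) IH bin2D binS bin1; ring.
Qed.

Lemma bin2M s i : 'C(s * i, 2) = i ^ 2 * 'C(s, 2) + s * 'C(i, 2).
Proof.
elim: s => [|s IH]; first by rewrite bin0n muln0.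
by rewrite mulSn bin2D IH binS bin1; ring.
Qed.

Lemma bin2_double x : 'C(2 * x + 1, 2) = x * (2 * x + 1).
Proof.
by elim: x => [|x IH] //; rewrite mulnS !addSn add0n !binS !bin1 bin0 IH; ring.
Qed.

Lemma expn_binomial3 e n : exists q, e.+1 ^ n = 1 + e * n + e ^ 2 * 'C(n, 2) + e ^ 3 * q.
Proof.
elim: n => [|n [q IH]]; first by exists 0; rewrite bin0n !muln0.
by exists (q * e.+1 + 'C(n, 2)); rewrite expnS IH binS bin1; ring.
Qed.

Lemma mul_gsum_binomial3 d n :
  exists q, d.+1 * gsum d.+1 n = n + d * 'C(n.+1, 2) + d ^ 2 * 'C(n.+1, 3) + d ^ 3 * q.
Proof.
elim: n => [|n [q IH]]; first by exists 0; rewrite gsum0 !muln0.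
exists (q * d.+1 + 'C(n.+1, 3)).
by rewrite gsumS [1 + _]addnC IH (binS n.+1) (binS n.+1 2) bin1; ring.
Qed.

Section Iteration.

Variables (v d0 e0 : nat).
Hypothesis v_gt0 : 0 < v.
Let h := 2 ^ v.
Let d := 2 * h * d0.
Let e := 2 * h * e0.
Let x := d.+1.
Let y := e.+1.
Let M := 2 * h ^ 3.

Lemma bin2_shift a z : exists q, 'C(a + 2 * h * z, 2) = 'C(a, 2) + h * q.
Proof.
rewrite bin2D; have := mul_bin_diag (2 * h * z) 1; rewrite bin1 => E.
exists (2 * z * a + z * (2 * h * z).-1).
suff -> : 'C(2 * h * z, 2) = h * z * (2 * h * z).-1 by ring.
by apply/eqP; rewrite -(eqn_pmul2l (isT : 0 < 2)) -E; apply/eqP; ring.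
Qed.

(** From [3 * 'C(n, 3) = n * 'C(n.-1, 2)]; the 3 can be cancelled because [h] is a power of 2. *)
Lemma bin3_dvd z : exists q, 'C(2 * h * z, 3) = h * q.
Proof.
have := mul_bin_diag (2 * h * z) 2 => E.
have : h %| 3 * 'C(2 * h * z, 3).
  by rewrite -E; apply/dvdnP; exists (2 * z * 'C((2 * h * z).-1, 2)); ring.
rewrite Gauss_dvdr; last by rewrite coprimeXl.
by case/dvdnP=> q ->; exists q; rewrite mulnC.
Qed.

Lemma bin3_shift a z : exists q, 'C(a + 2 * h * z, 3) = 'C(a, 3) + h * q.
Proof.
rewrite bin3D; have [q ->] := bin3_dvd z; have [r] := bin2_shift 0 z.
rewrite add0n bin0n add0n => ->.
by exists (2 * z * 'C(a, 2) + a * r + q); ring.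
Qed.

Lemma gsum_shift n q : exists r, x * gsum x (n + M * q) = x * gsum x n + M * r.
Proof.
have MM : M = 2 ^ (3 * v).+1 by rewrite /M /h -expnM (mulnC v) expnS.
have d2 : 2 %| d by rewrite /d -mulnA dvdn_mulr.
have d4 : 2 = 2 -> 4 %| d.
  by move=> _; apply: dvdn_mulr; rewrite (@dvdn_mul 2 2) // dvdn_exp.
have MMq : 2 ^ (3 * v).+1 %| M * q by rewrite MM dvdn_mulr.
have [r Er] := gsum_lift (isT : prime 2) d2 d4 MMq.
by exists (x * x ^ n * (q + 2 * r)); rewrite gsumD Er expnS -MM; ring.
Qed.

Lemma mul_gsum_shift i z : exists q, x * gsum x (i + d * z) =
  i + d * z + d * 'C(i.+1, 2) + 2 * h ^ 2 * d0 ^ 2 * z * (2 * i + 1) +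
  d ^ 2 * 'C(i.+1, 3) + M * q.
Proof.
have [q ->] := mul_gsum_binomial3 d (i + d * z).
have [r Er] := bin3_shift i.+1 (d0 * z).
have -> : (i + d * z).+1 = i.+1 + 2 * h * (d0 * z) by rewrite /d; lia.
rewrite Er.
have E2 : 'C(i.+1 + 2 * h * (d0 * z), 2) =
   'C(i.+1, 2) + h * d0 * z * (2 * i + 1) + 2 * h ^ 2 * d0 ^ 2 * z ^ 2.
  have := bin2_double (h * d0 * z); rewrite addn1 binS bin1 -addn1 => E.
  rewrite bin2D -(mulnA 2 h) -addn1 (mulnA h).
  apply/eqP; rewrite -(eqn_add2r (2 * (h * d0 * z))) -[X in X == _]addnA E.
  by apply/eqP; ring.
rewrite E2.
by exists (2 * d0 ^ 3 * z ^ 2 + 2 * d0 ^ 2 * r + 4 * d0 ^ 3 * q); rewrite /d /M; ring.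
Qed.

(** Collecting [a ^+ n * b] gives [b * c ^+ n * a ^+ step n]: right multiplication by [b] acts in
    this way on exponents of [a]. *)
Definition step n := x * gsum x n.

Lemma iter_step n i : exists q, iter n step i =
  i + d * n * 'C(i.+1, 2)
    + 2 * h ^ 2 * d0 ^ 2 * ('C(n, 2) * 'C(i.+1, 2) * (2 * i + 1) + 2 * n * 'C(i.+1, 3))
    + M * q.
Proof.
elim: n => [|n [q IH]]; first by exists 0; rewrite !(bin0n, muln0, mul0n, addn0).
rewrite iterS IH /step.
set T := 'C(i.+1, 2); set C3 := 'C(i.+1, 3).
set Y := 'C(n, 2) * T * (2 * i + 1) + 2 * n * C3.
(* Written as [i] plus a multiple of [d], the iterate can be fed to [mul_gsum_shift]. *)
have -> : i + d * n * T + 2 * h ^ 2 * d0 ^ 2 * Y = i + d * (n * T + h * d0 * Y).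
  by rewrite /d; ring.
have [r ->] := gsum_shift (i + d * (n * T + h * d0 * Y)) q.
have [r' ->] := mul_gsum_shift i (n * T + h * d0 * Y).
exists (d0 ^ 3 * Y * (2 * i + 1) + r' + r).
by rewrite /Y (binS n 1) bin1 -/T -/C3 /d /M; ring.
Qed.

(** Precision [4 * h ^ 2] suffices: when the sum is an exponent of [y], the error gains the factor
    [e], a multiple of [2 * h], and disappears modulo [M]. *)
Lemma sum_iter_step n i : exists q, \sum_(s < n) iter s step i =
  n * i + d * 'C(n, 2) * 'C(i.+1, 2)
    + 2 * h ^ 2 * d0 ^ 2 * 'C(n, 3) * 'C(i.+1, 2) * (2 * i + 1) + 4 * h ^ 2 * q.
Proof.
elim: n => [|n [q IH]]; first by exists 0; rewrite big_ord0 !(bin0n, muln0, mul0n, addn0).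
have [r Er] := iter_step n i; rewrite big_ord_recr /= Er IH (binS n 2) (binS n 1) bin1.
(* Halving [h] exhibits [M] as a multiple of [4 * h ^ 2]. *)
have hv : h = 2 * 2 ^ v.-1 by rewrite /h -expnS prednK.
have -> : M = 4 * h ^ 2 * 2 ^ v.-1 by rewrite /M expnS {1}hv; ring.
exists (q + d0 ^ 2 * n * 'C(i.+1, 3) + 2 ^ v.-1 * r).
by rewrite /d; ring.
Qed.

Lemma expn_sum_iter s i : exists q, y ^ (\sum_(r < s) iter r step i) =
  1 + e * s * i + e * d * 'C(s, 2) * 'C(i.+1, 2)
    + e ^ 2 * (i ^ 2 * 'C(s, 2) + s * 'C(i, 2)) + M * q.
Proof.
have [q Eq] := sum_iter_step s i.
have [r ->] := expn_binomial3 e (\sum_(r < s) iter r step i).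
set z := d0 * 'C(s, 2) * 'C(i.+1, 2)
  + h * d0 ^ 2 * 'C(s, 3) * 'C(i.+1, 2) * (2 * i + 1) + 2 * h * q.
have ES : \sum_(r < s) iter r step i = s * i + 2 * h * z.
  by rewrite Eq /d /z; ring.
have [t Et] := bin2_shift (s * i) z.
rewrite ES Et bin2M.
exists (2 * e0 * (d0 ^ 2 * 'C(s, 3) * 'C(i.+1, 2) * (2 * i + 1) + 2 * q)
        + 2 * e0 ^ 2 * t + 4 * e0 ^ 3 * r).
by rewrite /z /e /d /M; ring.
Qed.

Lemma sum_expn_sum_iter n i : exists q,
  \sum_(s < n) y ^ (\sum_(r < s) iter r step i) =
  n + e * i * 'C(n, 2) + e * d * 'C(n, 3) * 'C(i.+1, 2)
    + e ^ 2 * (i ^ 2 * 'C(n, 3) + 'C(n, 2) * 'C(i, 2)) + M * q.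
Proof.
elim: n => [|n [q IH]]; first by exists 0; rewrite big_ord0 !(bin0n, muln0, mul0n, addn0).
have [r Er] := expn_sum_iter n i; exists (q + r).
by rewrite big_ord_recr /= IH Er (binS n 2) (binS n 1) bin1; ring.
Qed.

Lemma bin2_y : 'C(y, 2) = h * e0 * y.
Proof.
have -> : y = 2 * (h * e0) + 1 by rewrite mulnA addn1.
exact: bin2_double.
Qed.

Lemma bin3_y : exists q, 'C(y, 3) = h * q.
Proof.
have [q Eq] := bin3_shift 1 e0.
by exists q; rewrite /y /e -add1n Eq.
Qed.

(** For [n = y] both ['C(n, 2)] and ['C(n, 3)] are multiples of [h], which removes most terms. This
    and the next two lemmas describe the action of [b ^+ y]. *)
Lemma iter_step_y i : exists q, iter y step i =
  i + d * y * 'C(i.+1, 2) + d ^ 2 * 'C(i.+1, 3) + M * q.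
Proof.
have [q ->] := iter_step y i; rewrite bin2_y.
exists (q + d0 ^ 2 * e0 * y * 'C(i.+1, 2) * (2 * i + 1)
        + 4 * d0 ^ 2 * e0 * 'C(i.+1, 3)).
by rewrite /y -[e.+1]addn1 /d /e /M; ring.
Qed.

Lemma sum_iter_step_y i : exists q, \sum_(s < y) iter s step i =
  y * i + 2 * h ^ 2 * d0 * e0 * 'C(i.+1, 2) + 4 * h ^ 2 * q.
Proof.
have [q ->] := sum_iter_step y i; have [r ->] := bin3_y; rewrite bin2_y.
have hv : h = 2 * 2 ^ v.-1 by rewrite /h -expnS prednK.
exists (q + 2 ^ v.-1 * d0 ^ 2 * r * 'C(i.+1, 2) * (2 * i + 1)
        + h * d0 * e0 ^ 2 * 'C(i.+1, 2)).
by rewrite /y -[e.+1]addn1 [in h * r]hv /d /e; ring.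
Qed.

Lemma sum_expn_sum_iter_y i : exists q,
  \sum_(s < y) y ^ (\sum_(r < s) iter r step i) =
  y + 2 * h ^ 2 * e0 ^ 2 * i + M * q.
Proof.
have [q ->] := sum_expn_sum_iter y i; have [r ->] := bin3_y; rewrite bin2_y.
exists (q + 2 * e0 ^ 3 * i + 2 * e0 * d0 * r * 'C(i.+1, 2)
  + 2 * e0 ^ 2 * (i ^ 2 * r + e0 * y * 'C(i, 2))).
by rewrite /y -[e.+1]addn1 /d /e /M; ring.
Qed.

Lemma step_mul i : exists q, step (x * i) =
  x * i + d * 'C(i.+1, 2) + d ^ 2 * 'C(i.+1, 3) + 2 * h ^ 2 * d0 ^ 2 * i * (2 * i + 1)
  + M * q.
Proof.
have [q Eq] := mul_gsum_shift i i; exists q.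
by rewrite /step {2}/x mulSn Eq /x mulSn; ring.
Qed.

End Iteration.

(** * The permutation model *)

(** Induction on [N]: once [2 ^ N %| r], [gsum_lift] makes [gsum d.+1 r] and [r] agree modulo
    [2 ^ N.+1]. *)
Lemma pow2_dvd_gsum N d r : 4 %| d -> 2 ^ N %| gsum d.+1 r -> 2 ^ N %| r.
Proof.
move=> d4; elim: N => [|N IH] dN; first by rewrite dvd1n.
have d2 : 2 %| d by apply: dvdn_trans d4.
have Nr : 2 ^ N %| r by apply/IH/dvdn_trans/dN; rewrite expnS dvdn_mull.
have [q Eq] := gsum_lift (isT : prime 2) d2 (fun=> d4) Nr.
by move: dN; rewrite Eq dvdn_addl ?dvdn_mulr.
Qed.

Local Open Scope ring_scope.

Section Model.

Variables (s t d0 e0 w0 : nat).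
Hypotheses (t_gt0 : (0 < t)%N) (e0_odd : odd e0) (w0_odd : odd w0).
Let K := (2 ^ s)%N.
Let D := (2 ^ t)%N.
Hypothesis d0E : d0 = (e0 + 2 * K * D * w0)%N.
Let v := (2 * s + t + 3)%N.
Let h := (2 ^ v)%N.
Let d := (2 * h * d0)%N.
Let e := (2 * h * e0)%N.
Let x := d.+1.
Let y := e.+1.
Let n1 := (32 * K ^ 3 * D ^ 2)%N.
Let n2 := (512 * K ^ 5 * D ^ 2)%N.
Let n3 := (1024 * K ^ 5 * D ^ 3)%N.

Lemma hE : h = (8 * K ^ 2 * D)%N.
Proof. by rewrite /h /v expnD (expnD _ (2 * s)) (mulnC 2 s) expnM; ring. Qed.

Lemma D_even : exists D', D = (2 * D')%N.
Proof. by exists (2 ^ t.-1)%N; rewrite -expnS prednK. Qed.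

(* The lattice of exponents (j, k, i) for which the word b^j c^k a^i acts
   trivially on the base point. *)
Definition null (j k i : int) : bool :=
  [&& (n1 %| k)%Z, (n2 %| w0%:Z * j + 4 * K%:Z * e0%:Z ^+ 2 * k)%Z
    & (n3 %| (D%:Z * w0%:Z - e0%:Z ^+ 2) * i + d0%:Z ^+ 2 * j
             + 4 * K%:Z * D%:Z * d0%:Z ^+ 2 * k)%Z].

Lemma nullB j k i j' k' i' :
  null j k i -> null j' k' i' -> null (j - j') (k - k') (i - i').
Proof.
case/and3P=> /dvdzP[a Ha] /dvdzP[b Hb] /dvdzP[c Hc].
case/and3P=> /dvdzP[a' Ha'] /dvdzP[b' Hb'] /dvdzP[c' Hc'].
apply/and3P; split; apply/dvdzP.
- by exists (a - a'); rewrite Ha Ha'; ring.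
- by exists (b - b'); rewrite [RHS]mulrBl -Hb -Hb'; ring.
by exists (c - c'); rewrite [RHS]mulrBl -Hc -Hc'; ring.
Qed.

Lemma null0 : null 0 0 0.
Proof. by rewrite /null !mulr0 !addr0 !dvdz0. Qed.

Lemma nullN j k i : null j k i -> null (- j) (- k) (- i).
Proof. by move=> H; have := nullB null0 H; rewrite !sub0r. Qed.

Lemma nullD j k i j' k' i' :
  null j k i -> null j' k' i' -> null (j + j') (k + k') (i + i').
Proof. by move=> H /nullN H'; have := nullB H H'; rewrite !opprK. Qed.

Lemma oddz (n : nat) : odd n -> exists z : int, n%:Z = 1 + 2 * z.
Proof. by move=> on; exists n./2%:Z; have := odd_double_half n; rewrite on; lia. Qed.

Lemma d0_odd : odd d0.
Proof. by rewrite d0E oddD e0_odd -!mulnA oddM. Qed.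

Lemma coprimez_pow2 N (b : int) : coprimez (2 ^ N)%N (1 + 2 * b).
Proof.
rewrite coprimezE absz_nat coprimeXl // prime_coprime // -(dvdzE 2%N).
apply/negP=> /dvdzP[c E]; lia.
Qed.

Lemma pow2_solve N (b z : int) : exists j : nat, ((2 ^ N)%N %| (1 + 2 * b) * j%:Z - z)%Z.
Proof.
have /coprimezP[[u w] /= E] := coprimez_pow2 N b.
have n0 : (2 ^ N)%N%:Z != 0 by rewrite eqz_nat -lt0n expn_gt0.
exists `|((w * z) %% (2 ^ N)%N)%Z|%N; rewrite gez0_abs ?modz_ge0 //.
apply/dvdzP; exists (- (u * z) - (1 + 2 * b) * (w * z %/ (2 ^ N)%N)%Z).
have := divz_eq (w * z) (2 ^ N)%N.
move: (w * z %/ (2 ^ N)%N)%Z (w * z %% (2 ^ N)%N)%Z => q r Er.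
have -> : r = w * z - q * (2 ^ N)%N by rewrite Er; ring.
transitivity ((u * (2 ^ N)%N + w * (1 + 2 * b)) * z - z
  + (- (u * z) - (1 + 2 * b) * q) * (2 ^ N)%N); first by ring.
by rewrite E mul1r subrr add0r.
Qed.

(** The index [n.-1.+1] keeps the type inhabited, as [inord] requires; it equals [n] when
    [0 < n]. *)
Definition residue (n : nat) (z : int) : 'I_n.-1.+1 := inord `|(z %% n)%Z|.

Lemma residue_eq n (z z' : int) : (0 < n)%N ->
  (residue n z == residue n z') = (n %| z' - z)%Z.
Proof.
move=> n0; have lt w : (`|(w %% n)%Z|%N < n.-1.+1)%N.
  by rewrite prednK // -ltz_nat gez0_abs ?modz_ge0 ?ltz_pmod // ?eqz_nat -?lt0n.
rewrite -val_eqE /= !inordK // -eqz_nat !gez0_abs ?modz_ge0 // ?eqz_nat -?lt0n //.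
by rewrite eq_sym eqz_mod_dvd.
Qed.

Lemma pow2_gauss N (a b : int) :
  ((2 ^ N)%N %| (1 + 2 * b) * a)%Z -> ((2 ^ N)%N %| a)%Z.
Proof. by rewrite Gauss_dvdzr // coprimez_pow2. Qed.

Lemma oddz_sqr_gauss N c (z : int) : odd c ->
  ((2 ^ N)%N %| c%:Z ^+ 2 * z)%Z -> ((2 ^ N)%N %| z)%Z.
Proof.
move=> /oddz[c1 Ec].
have -> : c%:Z ^+ 2 = 1 + 2 * (2 * c1 ^+ 2 + 2 * c1) by rewrite Ec; ring.
exact: pow2_gauss.
Qed.

(** As [w0] and [D * w0 - e0 ^ 2] are odd, the second and third conditions force [2 * h ^ 2] to
    divide [j] and [i]. Divided by [2 * h ^ 2] and read modulo 2, they give the cofactor of [j] the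
    parity of both [a] and [b]. *)
Lemma null_kernel j k i : null j k i ->
  exists a b : int, [/\ k = n1%:Z * a, i = (2 * h ^ 2)%N%:Z * b & (2 %| b - a)%Z].
Proof.
case/and3P=> /dvdzP[a ka] /dvdzP[q2 H2] /dvdzP[q3 H3].
have [w1 Ew] := oddz w0_odd; have [e1 Ee] := oddz e0_odd.
have [d1 Ed] := oddz d0_odd; have [D' ED] := D_even.
have hh : (2 * h ^ 2)%N = (2 ^ (2 * v).+1)%N by rewrite /h -expnM (mulnC v) expnS.
have hK : (2 * h ^ 2)%N = (128 * K ^ 4 * D ^ 2)%N by rewrite hE; ring.
have Qj : ((2 * h ^ 2)%N %| j)%Z.
  rewrite hh; apply: (@pow2_gauss _ _ w1); rewrite -hh -Ew hK.
  apply/dvdzP; exists (4 * K%:Z * q2 - e0%:Z ^+ 2 * a).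
  have -> : w0%:Z * j = q2 * n2%:Z - 4 * K%:Z * e0%:Z ^+ 2 * k by rewrite -H2; ring.
  by rewrite ka /n1 /n2; ring.
have [c jc] := dvdzP Qj.
have Qi : ((2 * h ^ 2)%N %| i)%Z.
  rewrite hh; apply: (@pow2_gauss _ _ (D'%:Z * w0%:Z - 2 * e1 ^+ 2 - 2 * e1 - 1)); rewrite -hh hK.
  apply/dvdzP; exists (8 * K%:Z * D%:Z * q3 - d0%:Z ^+ 2 * c - D%:Z * d0%:Z ^+ 2 * a).
  have -> : (1 + 2 * (D'%:Z * w0%:Z - 2 * e1 ^+ 2 - 2 * e1 - 1)) * i =
    q3 * n3%:Z - d0%:Z ^+ 2 * j - 4 * K%:Z * D%:Z * d0%:Z ^+ 2 * k.
    by rewrite -H3 Ee ED; ring.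
  by rewrite ka jc hK /n1 /n3; ring.
have [b ib] := dvdzP Qi.
have Q0 : (2 * h ^ 2)%N%:Z != 0 by rewrite hh; have := expn_gt0 2 (2 * v).+1; lia.
exists a, b; split; [by rewrite ka mulrC | by rewrite ib mulrC |].
have E2 : w0%:Z * c + e0%:Z ^+ 2 * a = 4 * K%:Z * q2.
  apply: (mulIf Q0).
  transitivity (w0%:Z * (c * (2 * h ^ 2)%N) + e0%:Z ^+ 2 * a * (2 * h ^ 2)%N); first by ring.
  rewrite -jc.
  have -> : w0%:Z * j = q2 * n2%:Z - 4 * K%:Z * e0%:Z ^+ 2 * k by rewrite -H2; ring.
  by rewrite ka hK /n1 /n2; ring.
have E3 : (D%:Z * w0%:Z - e0%:Z ^+ 2) * b + d0%:Z ^+ 2 * c + D%:Z * d0%:Z ^+ 2 * a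
          = 8 * K%:Z * D%:Z * q3.
  apply: (mulIf Q0).
  transitivity ((D%:Z * w0%:Z - e0%:Z ^+ 2) * (b * (2 * h ^ 2)%N)
    + d0%:Z ^+ 2 * (c * (2 * h ^ 2)%N) + D%:Z * d0%:Z ^+ 2 * a * (2 * h ^ 2)%N); first by ring.
  rewrite -ib -jc.
  have -> : (D%:Z * w0%:Z - e0%:Z ^+ 2) * i = q3 * n3%:Z - d0%:Z ^+ 2 * j - 4 * K%:Z * D%:Z * d0%:Z ^+ 2 * k.
    by rewrite -H3; ring.
  by rewrite ka hK /n1 /n3; ring.
rewrite ED in E2 E3.
set X := 2 * K%:Z * q2 - w1 * c - (2 * e1 + 2 * e1 ^+ 2) * a.
set Y := 8 * K%:Z * D'%:Z * q3 - D'%:Z * w0%:Z * b + (2 * e1 + 2 * e1 ^+ 2) * b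
         - (2 * d1 + 2 * d1 ^+ 2) * c - D'%:Z * d0%:Z ^+ 2 * a.
have EX : c + a = 2 * X.
  transitivity (2 * X + (w0%:Z * c + e0%:Z ^+ 2 * a - 4 * K%:Z * q2)).
    by rewrite /X Ew Ee; ring.
  by rewrite E2 subrr addr0.
have EY : c - b = 2 * Y.
  transitivity (2 * Y + (((2 * D')%N%:Z * w0%:Z - e0%:Z ^+ 2) * b + d0%:Z ^+ 2 * c
     + (2 * D')%N%:Z * d0%:Z ^+ 2 * a - 8 * K%:Z * (2 * D')%N%:Z * q3)).
    by rewrite /Y Ee Ed; ring.
  by rewrite E3 subrr addr0.
apply/dvdzP; exists (X - a - Y).
transitivity (c + a - 2 * a - (c - b)); first by ring.
by rewrite EX EY; ring.
Qed.

(** The constant is [n3 / 2]. In the third form [j] and [k] contribute [n3 / 2] times [d0 ^ 2 * a]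
    and [d0 ^ 2 * b], and the two cancel modulo [n3] because [a] and [b] have the same parity. *)
Lemma null_correction j k i (a b : int) : k = (2 * h ^ 2)%N%:Z * b ->
  (2 %| b - a)%Z -> (n3 %| j - (512 * K ^ 5 * D ^ 3)%N%:Z * a)%Z -> (n3 %| i)%Z ->
  null j k i.
Proof.
move=> -> /dvdzP[c bc] /dvdzP[q jq] /dvdzP[q' iq].
have hK : (2 * h ^ 2)%N = (128 * K ^ 4 * D ^ 2)%N by rewrite hE; ring.
have -> : j = (512 * K ^ 5 * D ^ 3)%N%:Z * a + q * n3%:Z by rewrite -jq; ring.
have -> : b = a + c * 2 by rewrite -bc; ring.
rewrite iq hK /null /n1 /n2 /n3; apply/and3P; split; apply/dvdzP.
- by exists (4 * K%:Z * (a + c * 2)); ring.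
- exists (w0%:Z * D%:Z * a + w0%:Z * q * 2 * D%:Z + e0%:Z ^+ 2 * (a + c * 2)).
  by ring.
exists ((D%:Z * w0%:Z - e0%:Z ^+ 2) * q' + d0%:Z ^+ 2 * (a + q + c)).
by ring.
Qed.

(** Here [y ^ r - 1 = e * gsum y r] is [e * r] up to a multiple of [2 * e * n1], and [e * n1] is an
    odd multiple of [n3 / 2]. *)
Lemma expn_diff (k k' : nat) a : k'%:Z - k%:Z = n1%:Z * a ->
  (n3 %| (y ^ k')%N%:Z - (y ^ k)%N%:Z - (512 * K ^ 5 * D ^ 3)%N%:Z * a)%Z.
Proof.
wlog le_kk' : k k' a / (k <= k')%N => [IH|].
  case: (leqP k k') => [|/ltnW] le_kk' ka; first exact: IH.
  have /(IH _ _ _ le_kk')/dvdzP[q Eq] : k%:Z - k'%:Z = n1%:Z * - a by rewrite mulrN -ka; ring.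
  apply/dvdzP; by exists (- q); rewrite mulNr -Eq; ring.
rewrite -{1}(subnKC le_kk') -(subnKC le_kk'); set r := (k' - k)%N => ka.
have n1v : n1 = (2 ^ (3 * s + 2 * t + 5))%N.
  by rewrite /n1 expnD (expnD _ (3 * s)) (mulnC 3 s) (mulnC 2 t) !expnM -/K -/D; ring.
have rdv : (2 ^ (3 * s + 2 * t + 5) %| r)%N.
  rewrite -n1v; apply/dvdnP; exists `|a|%N; lia.
have d2 : (2 %| e)%N by rewrite /e -mulnA dvdn_mulr.
have h4 : (4 %| e)%N.
  rewrite /e hE; apply/dvdnP; exists (4 * K ^ 2 * D * e0)%N; ring.
have [q Eq] := gsum_lift (isT : prime 2) d2 (fun=> h4) rdv.
have E1 := expn_gsum e r; have E2 := expn_gsum e k.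
rewrite expnS -n1v in Eq.
have ra : r%:Z = n1%:Z * a by rewrite -ka; lia.
have [e1 Ee] := oddz e0_odd.
apply/dvdzP; rewrite expnD /y E1 Eq E2.
move: (gsum e.+1 k) => G.
exists (e1 * a + e0%:Z * q%:Z + h%:Z * e0%:Z ^+ 2 * G%:Z * (a + 2 * q%:Z)).
have ez : e%:Z = 16 * K%:Z ^+ 2 * D%:Z * (1 + 2 * e1) by rewrite /e hE -Ee; ring.
have -> : ((1 + e * G) * (1 + e * (r + 2 * n1 * q)))%N%:Z
  = (1 + e%:Z * G%:Z) * (1 + e%:Z * (r%:Z + 2 * n1%:Z * q%:Z)) by ring.
have -> : (1 + e * G)%N%:Z = 1 + e%:Z * G%:Z by ring.
rewrite ra ez /n1 /n3 hE Ee; ring.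
Qed.

Let M := (2 * h ^ 3)%N.

Lemma M_eq : M = (K * n3)%N.
Proof. by rewrite /M /n3 hE; ring. Qed.

Lemma stepE n : step v d0 n = (d.+1 * gsum d.+1 n)%N.
Proof. by []. Qed.

(** The increment of [step] over [r = i' - i] is [x ^ i * step r]; since [2 * h ^ 2 %| r], it equals
    [r] modulo [M], a multiple of [n3]. *)
Lemma step_diff (i i' : nat) b : i'%:Z - i%:Z = (2 * h ^ 2)%N%:Z * b ->
  (n3 %| (step v d0 i')%:Z - (step v d0 i)%:Z - (i'%:Z - i%:Z))%Z.
Proof.
wlog le_ii' : i i' b / (i <= i')%N => [IH|].
  case: (leqP i i') => [|/ltnW] le_ii' ib; first exact: IH ib.
  have /(IH _ _ _ le_ii')/dvdzP[q Eq] : i%:Z - i'%:Z = (2 * h ^ 2)%N%:Z * - b.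
    by rewrite mulrN -ib; ring.
  by apply/dvdzP; exists (- q); rewrite mulNr -Eq; ring.
rewrite -(subnKC le_ii'); set r := (i' - i)%N => rb.
have h0 : (0 < 2 * h ^ 2)%N by rewrite !(muln_gt0, expn_gt0).
have [c rc] : exists c : nat, r = (2 * (h ^ 2 * c))%N.
  exists `|b|%N; apply/eqP; rewrite -eqz_nat mulnA.
  have b0 : 0 <= b.
    rewrite -(@Num.Theory.pmulr_rge0 _ (2 * h ^ 2)%N%:Z) -?rb //.
    by rewrite PoszD addrAC subrr add0r.
  by rewrite PoszM gez0_abs // -rb PoszD addrAC subrr add0r.
have [q Eq] := mul_gsum_binomial3 d r.
have [q3 Eq3] := bin3_shift v 1 (h * c).
have E3 : 'C(r.+1, 3) = (h * q3)%N.
  by rewrite -[RHS]Eq3; congr ('C(_, _)); rewrite rc -add1n; ring.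
have E2 : 'C(r.+1, 2) = (h ^ 2 * c * (2 * (h ^ 2 * c) + 1))%N.
  by rewrite -bin2_double rc addn1.
have Er : step v d0 (i + r) = (step v d0 i + (1 + d * gsum d.+1 i) * (d.+1 * gsum d.+1 r))%N.
  by rewrite !stepE gsumD -expn_gsum; ring.
rewrite E2 E3 in Eq; rewrite Er Eq.
move: (step v d0 i) (gsum d.+1 i) => g G.
apply: (@dvdz_trans M); first by rewrite M_eq; apply/dvdzP; exists K%:Z; ring.
apply/dvdzP.
exists (d0%:Z * c%:Z * 2 * G%:Z + (1 + d%:Z * G%:Z) *
   (d0%:Z * c%:Z * (2 * (h%:Z ^+ 2 * c%:Z) + 1) + 2 * d0%:Z ^+ 2 * q3%:Z + 4 * d0%:Z ^+ 3 * q%:Z)).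
have -> : (g + (1 + d * G) * (r + d * (h ^ 2 * c * (2 * (h ^ 2 * c) + 1)) + d ^ 2 * (h * q3) + d ^ 3 * q))%N%:Z
 = g%:Z + (1 + d%:Z * G%:Z) * (r%:Z + d%:Z * (h%:Z ^+ 2 * c%:Z * (2 * (h%:Z ^+ 2 * c%:Z) + 1)) + d%:Z ^+ 2 * (h%:Z * q3%:Z) + d%:Z ^+ 3 * q%:Z) by ring.
have dz : d%:Z = 2 * h%:Z * d0%:Z by rewrite /d; ring.
have rz : r%:Z = 2 * (h%:Z ^+ 2 * c%:Z) by rewrite rc; ring.
have -> : (i + r)%N%:Z - i%:Z = r%:Z by ring.
have -> : M%:Z = 2 * h%:Z ^+ 3 by rewrite /M; ring.
rewrite rz dz; ring.
Qed.

Lemma step_dvd (i i' : nat) : ((2 * h ^ 2)%N %| (step v d0 i')%:Z - (step v d0 i)%:Z)%Z ->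
  ((2 * h ^ 2)%N %| i'%:Z - i%:Z)%Z.
Proof.
wlog le_ii' : i i' / (i <= i')%N => [IH|].
  case: (leqP i i') => [|/ltnW] le_ii'; first exact: IH.
  have dvdzN q z : (q %| - z)%Z = (q %| z)%Z by rewrite !dvdzE abszN.
  by rewrite -dvdzN opprB => /(IH _ _ le_ii'); rewrite -dvdzN opprB.
rewrite -(subnKC le_ii'); set r := (i' - i)%N.
have -> : (i + r)%N%:Z - i%:Z = r%:Z by ring.
have -> : (step v d0 (i + r))%:Z - (step v d0 i)%:Z = (d.+1 ^ i.+1 * gsum d.+1 r)%N%:Z.
  by rewrite !stepE gsumD expnS; move: (d.+1 ^ i)%N => t'; ring.
have -> : (2 * h ^ 2)%N = (2 ^ (2 * v).+1)%N by rewrite /h -expnM (mulnC v) expnS.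
have d4 : (4 %| d)%N.
  by rewrite /d hE; apply/dvdnP; exists (4 * K ^ 2 * D * d0)%N; ring.
rewrite !dvdzE !absz_nat Gauss_dvdr; first exact: pow2_dvd_gsum.
rewrite coprimeXl // coprimeXr // coprime2n /= -dvdn2.
by apply: dvdn_trans d4.
Qed.

(** * Action on triples of exponents *)

Local Notation triple := (nat * nat * nat)%type.

(* Right multiplication by a, b and c = [a, b] of the word b^j c^k a^i encoded
   by (j, k, i). *)
Definition mact_a (p : triple) : triple := let: (j, k, i) := p in (j, k, i.+1).
Definition mact_b (p : triple) : triple :=
  let: (j, k, i) := p in ((j + y ^ k)%N, (k + i)%N, step v d0 i).
Definition mact_c (p : triple) : triple := let: (j, k, i) := p in (j, k.+1, (x * i)%N).

Definition equiv (p p' : triple) : bool :=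
  null (p'.1.1%:Z - p.1.1%:Z) (p'.1.2%:Z - p.1.2%:Z) (p'.2%:Z - p.2%:Z).

Lemma equiv_a p p' : equiv (mact_a p) (mact_a p') = equiv p p'.
Proof.
case: p p' => [[j k] i] [[j' k'] i']; rewrite /equiv /=.
by have -> : i'.+1%:Z - i.+1%:Z = i'%:Z - i%:Z by ring.
Qed.

(** The map changes the difference of two triples by a vector that [null_correction] places in the
    lattice. For the converse, [step_dvd] first recovers that [2 * h ^ 2] divides [i' - i]. Both
    directions are needed for a well-defined injective map on classes. *)
Lemma equiv_b p p' : equiv (mact_b p) (mact_b p') = equiv p p'.
Proof.
case: p p' => [[j k] i] [[j' k'] i']; rewrite /equiv /=.
have diff b a : i'%:Z - i%:Z = (2 * h ^ 2)%N%:Z * b -> k'%:Z - k%:Z = n1%:Z * a ->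
  (2 %| b - a)%Z -> null ((y ^ k')%N%:Z - (y ^ k)%N%:Z) (i'%:Z - i%:Z)
    ((step v d0 i')%:Z - (step v d0 i)%:Z - (i'%:Z - i%:Z)).
  move=> ib ka ab; apply: (null_correction ib ab); first exact: expn_diff.
  exact: step_diff ib.
apply/idP/idP => H.
  have [a' [b' [Ea Eb /dvdzP[c ab]]]] := null_kernel H.
  have /dvdzP[b ib] : ((2 * h ^ 2)%N %| i'%:Z - i%:Z)%Z.
    by apply: step_dvd; rewrite Eb; apply/dvdzP; exists b'; rewrite mulrC.
  rewrite mulrC in ib.
  have /dvdzP[q Eq] := step_diff ib.
  have hK : (2 * h ^ 2)%N = (128 * K ^ 4 * D ^ 2)%N by rewrite hE; ring.
  have h0 : (2 * h ^ 2)%N%:Z != 0 by rewrite eqz_nat -lt0n !(muln_gt0, expn_gt0).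
  (* The factor [8 * K * D] is [n3] divided by [2 * h ^ 2]. *)
  have Ebb : b' = b + q * (8 * K%:Z * D%:Z).
    apply: (mulfI h0); rewrite mulrDr -ib -Eb.
    transitivity (i'%:Z - i%:Z + ((step v d0 i')%:Z - (step v d0 i)%:Z - (i'%:Z - i%:Z))).
      by ring.
    by rewrite Eq hK /n3; ring.
  have Ek : k'%:Z - k%:Z = n1%:Z * (a' - 4 * K%:Z * b).
    transitivity ((k' + i')%N%:Z - (k + i)%N%:Z - (i'%:Z - i%:Z)); first by ring.
    by rewrite Ea ib hK /n1; ring.
  have /(diff _ _ ib Ek) H' : (2 %| b - (a' - 4 * K%:Z * b))%Z.
    apply/dvdzP; exists (c - 4 * q * K%:Z * D%:Z + 2 * K%:Z * b).
    transitivity (b' - a' - q * (8 * K%:Z * D%:Z) + 4 * K%:Z * b); first by rewrite Ebb; ring.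
    by rewrite ab; ring.
  have := nullB H H'; congr (null _ _ _); ring.
have [a [b [Ea Eb ab]]] := null_kernel H.
have := nullD H (diff _ _ Eb Ea ab); congr (null _ _ _); ring.
Qed.

(** One direction is enough: the permutation for [c] is obtained as a commutator, so its injectivity
    is automatic. The difference changes only by [d * (i' - i)] in the last place, a multiple of
    [M]. *)
Lemma equiv_c p p' : equiv p p' -> equiv (mact_c p) (mact_c p').
Proof.
case: p p' => [[j k] i] [[j' k'] i']; rewrite /equiv /= => H.
have [a [b [Ea Eb /dvdzP[c ab]]]] := null_kernel H.
suff H' : null 0 0 (d%:Z * (i'%:Z - i%:Z)).
  by have := nullD H H'; congr (null _ _ _); rewrite /x; ring.
rewrite /null !mulr0 !addr0 !dvdz0 /=; apply: dvdz_mull.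
apply: (@dvdz_trans M); first by rewrite M_eq; apply/dvdzP; exists K%:Z; ring.
by rewrite Eb; apply/dvdzP; exists (2 * d0%:Z * b); rewrite /M /d; ring.
Qed.

(** The identities [a b = b a c] and, in [mact_ac], [a c = c a^x] hold for the triples themselves;
    [c b = b^y c] in [mact_cb] holds only modulo the lattice. *)
Lemma mact_ab p : mact_c (mact_a (mact_b p)) = mact_b (mact_a p).
Proof.
case: p => [[j k] i]; rewrite /= addnS; congr (_, _, _).
by rewrite !stepE gsumS add1n.
Qed.

Lemma iter_mact_a n j k i : iter n mact_a (j, k, i) = (j, k, (i + n)%N).
Proof. by elim: n => [|n IH]; rewrite ?addn0 // iterS IH /= addnS. Qed.

Lemma mact_ac p : mact_c (mact_a p) = iter x mact_a (mact_c p).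
Proof. by case: p => [[j k] i]; rewrite iter_mact_a /= mulnS addnC. Qed.

Lemma iter_mact_b n j k i : iter n mact_b (j, k, i) =
  ((j + y ^ k * \sum_(s < n) y ^ (\sum_(r < s) iter r (step v d0) i))%N,
   (k + \sum_(s < n) iter s (step v d0) i)%N, iter n (step v d0) i).
Proof.
elim: n => [|n IH]; first by rewrite !big_ord0 muln0 !addn0.
rewrite iterS IH /= !big_ord_recr /=; congr (_, _, _); last by rewrite addnA.
by rewrite expnD mulnDr addnA.
Qed.

Lemma mact_cb p : equiv (mact_b (mact_c p)) (mact_c (iter y mact_b p)).
Proof.
case: p => [[j k] i]; rewrite iter_mact_b /equiv /= -(iterS e).
have v0 : (0 < v)%N by rewrite /v addn_gt0 orbT.
have [qj] := sum_expn_sum_iter_y d0 e0 v0 i; rewrite -/h -/d -/e -/x -/y -/M => ->.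
have [qk] := sum_iter_step_y d0 e0 v0 i; rewrite -/h -/d -/e -/x -/y -/M => ->.
have [qi] := iter_step_y d0 e0 v0 i; rewrite -/h -/d -/e -/x -/y -/M => ->.
have [qs] := step_mul d0 e0 v0 i; rewrite -/h -/d -/e -/x -/y -/M => ->.
rewrite (expnS y k).
have [U EU] : exists z : int, (e0 ^ 2 * w0)%N%:Z = 1 + 2 * z.
  by apply: oddz; rewrite oddM oddX e0_odd.
have [V EV] : exists z : int, (d0 ^ 2 * e0)%N%:Z = 1 + 2 * z.
  by apply: oddz; rewrite oddM oddX d0_odd.
have [D' ED] := D_even.
(* This trades the square of [i] for the binomial [T], leaving a linear term that the lattice can
   match. *)
have ET : i%:Z * (2 * i%:Z + 1) = 4 * 'C(i.+1, 2)%:Z - i%:Z.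
  have := mul_bin_diag i.+1 1; rewrite bin1 /= => E.
  have -> : 4 * 'C(i.+1, 2)%:Z = 2 * (2 * 'C(i.+1, 2))%N%:Z by ring.
  by rewrite -E; ring.
have Ek := expn_gsum e k; rewrite -/y in Ek.
move: (gsum e.+1 k) Ek => G Ek.
move: ('C(i.+1, 2)) ('C(i.+1, 3)) ET => T C3 ET.
have Ed0 : d0%:Z = e0%:Z + 2 * K%:Z * D%:Z * w0%:Z by rewrite d0E; ring.
set R := 4 * d0%:Z ^+ 2 * e0%:Z * T%:Z + 4 * d0%:Z ^+ 3 * C3%:Z + x%:Z * qi%:Z - qs%:Z.
have -> : (j + y ^ k * (y + 2 * h ^ 2 * e0 ^ 2 * i + M * qj))%N%:Z - (j + y * y ^ k)%N%:Z
    = 2 * h%:Z ^+ 2 * e0%:Z ^+ 2 * i%:Z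
      + M%:Z * (2 * e0%:Z ^+ 3 * G%:Z * i%:Z + (1 + e%:Z * G%:Z) * qj%:Z).
  by rewrite Ek /e /M; ring.
have -> : (k + (y * i + 2 * h ^ 2 * d0 * e0 * T + 4 * h ^ 2 * qk)).+1%:Z - (k.+1 + x * i)%N%:Z
    = n1%:Z * (- w0%:Z * i%:Z + 4 * K%:Z * d0%:Z * e0%:Z * T%:Z + 8 * K%:Z * qk%:Z).
  transitivity (2 * h%:Z * (e0%:Z - d0%:Z) * i%:Z + 2 * h%:Z ^+ 2 * d0%:Z * e0%:Z * T%:Z
                + 4 * h%:Z ^+ 2 * qk%:Z); first by rewrite /x /y /d /e; ring.
  have -> : e0%:Z - d0%:Z = - (2 * K%:Z * D%:Z * w0%:Z) by rewrite Ed0; ring.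
  by rewrite /n1 hE; ring.
have -> : (x * (i + d * y * T + d ^ 2 * C3 + M * qi))%N%:Z -
    (x * i + d * T + d ^ 2 * C3 + 2 * h ^ 2 * d0 ^ 2 * i * (2 * i + 1) + M * qs)%N%:Z
    = 2 * h%:Z ^+ 2 * d0%:Z ^+ 2 * i%:Z
      - (512 * K ^ 5 * D ^ 3)%N%:Z * d0%:Z * w0%:Z * T%:Z + M%:Z * R.
  transitivity (4 * h%:Z ^+ 2 * d0%:Z * (d0%:Z + e0%:Z) * T%:Z
    - 2 * h%:Z ^+ 2 * d0%:Z ^+ 2 * (i%:Z * (2 * i%:Z + 1)) + M%:Z * R).
    by rewrite /R /x /y /d /e /M; ring.
  rewrite ET.
  transitivity (2 * h%:Z ^+ 2 * d0%:Z ^+ 2 * i%:Z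
    - 4 * h%:Z ^+ 2 * d0%:Z * (d0%:Z - e0%:Z) * T%:Z + M%:Z * R); first by ring.
  have -> : d0%:Z - e0%:Z = 2 * K%:Z * D%:Z * w0%:Z by rewrite Ed0; ring.
  by rewrite hE; ring.
rewrite M_eq; set Q := 2 * e0%:Z ^+ 3 * _ * _ + _.
apply/and3P; split; first by apply: dvdz_mulr; exact: dvdzz.
- apply/dvdzP; exists (2 * K%:Z * D%:Z * w0%:Z * Q
    + e0%:Z ^+ 2 * (d0%:Z * e0%:Z * T%:Z + 2 * qk%:Z)).
  by rewrite /n1 /n2 /n3 hE; ring.
(* What is not visibly divisible by [n3] is [n3 / 2] times a multiple of
   [e0 ^ 2 * w0 + d0 ^ 2 * e0 - D * w0 ^ 2]: two odd terms and an even one. *)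
apply/dvdzP; exists (d0%:Z ^+ 2 * qk%:Z + (D%:Z * w0%:Z - e0%:Z ^+ 2) * K%:Z * R
  + K%:Z * d0%:Z ^+ 2 * Q + T%:Z * d0%:Z * (1 + U + V - D'%:Z * w0%:Z ^+ 2)).
transitivity ((d0%:Z ^+ 2 * qk%:Z + (D%:Z * w0%:Z - e0%:Z ^+ 2) * K%:Z * R
    + K%:Z * d0%:Z ^+ 2 * Q) * n3%:Z
  + (512 * K ^ 5 * D ^ 3)%N%:Z * T%:Z * d0%:Z *
     ((e0 ^ 2 * w0)%N%:Z + (d0 ^ 2 * e0)%N%:Z - D%:Z * w0%:Z ^+ 2)).
  by rewrite /n1 /n3 hE; ring.
by rewrite EU EV ED /n3 ED; ring.
Qed.

(** * The finite quotient and its permutations *)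

Lemma moduli_gt0 : [/\ (0 < n1)%N, (0 < n2)%N & (0 < n3)%N].
Proof. by rewrite !(muln_gt0, expn_gt0). Qed.

Definition model_point : finType := ('I_n1.-1.+1 * 'I_n2.-1.+1 * 'I_n3.-1.+1)%type.

(** The forms in [null] identify the quotient by the lattice with a product of three cyclic groups,
    which makes its cardinality immediate. *)
Definition class_of (p : triple) : model_point :=
  let: (j, k, i) := p in
  (residue n1 k%:Z, residue n2 (w0%:Z * j%:Z + 4 * K%:Z * e0%:Z ^+ 2 * k%:Z),
   residue n3 ((D%:Z * w0%:Z - e0%:Z ^+ 2) * i%:Z + d0%:Z ^+ 2 * j%:Z
             + 4 * K%:Z * D%:Z * d0%:Z ^+ 2 * k%:Z)).

Lemma class_of_eq p p' : (class_of p == class_of p') = equiv p p'.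
Proof.
have [p1 p2 p3] := moduli_gt0.
case: p p' => [[j k] i] [[j' k'] i']; rewrite /equiv /null /class_of /=.
rewrite !xpair_eqE !residue_eq // -andbA; congr [&& _, (_ %| _)%Z & (_ %| _)%Z]; ring.
Qed.

Lemma n2_pow2 : n2 = (2 ^ (5 * s + 2 * t + 9))%N.
Proof. by rewrite /n2 expnD (expnD _ (5 * s)) (mulnC 5 s) (mulnC 2 t) !expnM -/K -/D; ring. Qed.

Lemma n3_pow2 : n3 = (2 ^ (5 * s + 3 * t + 10))%N.
Proof. by rewrite /n3 expnD (expnD _ (5 * s)) (mulnC 5 s) (mulnC 3 t) !expnM -/K -/D; ring. Qed.

(** The system is triangular: take [k] from the first coordinate, then solve for [j] and then for
    [i], whose coefficients are odd. *)
Lemma class_of_surj X : exists p, class_of p == X.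
Proof.
have [p1 p2 p3] := moduli_gt0.
have [w1 Ew] := oddz w0_odd; have [e1 Ee] := oddz e0_odd; have [D' ED] := D_even.
case: X => [[r1 r2] r3].
have [j Hj] := pow2_solve (5 * s + 2 * t + 9) w1
  ((r2 : nat)%:Z - 4 * K%:Z * e0%:Z ^+ 2 * (r1 : nat)%:Z).
have [i Hi] := pow2_solve (5 * s + 3 * t + 10) (D'%:Z * w0%:Z - 2 * e1 ^+ 2 - 2 * e1 - 1)
  ((r3 : nat)%:Z - d0%:Z ^+ 2 * j%:Z - 4 * K%:Z * D%:Z * d0%:Z ^+ 2 * (r1 : nat)%:Z).
have res n (r : 'I_n.-1.+1) : (0 < n)%N -> r = residue n (r : nat)%:Z.
  move=> n0; apply: val_inj; rewrite /= inordK modz_small ?absz_nat //.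
  by have := ltn_ord r; rewrite {2}prednK // ltz_nat.
  by have := ltn_ord r; rewrite {2}prednK // ltz_nat.
have dvdzB n (z z' : int) : (n %| z - z')%Z = (n %| z' - z)%Z.
  by rewrite -opprB !dvdzE abszN.
exists (j, r1 : nat, i); rewrite [in X in _ == X](res _ r1) // [in X in _ == X](res _ r2) //.
rewrite [in X in _ == X](res _ r3) // /class_of !xpair_eqE eqxx !residue_eq //=.
rewrite (dvdzB _ (r2 : nat)) (dvdzB _ (r3 : nat)); apply/andP; split.
  by move: Hj; rewrite -n2_pow2; congr (is_true (_ %| _)%Z); rewrite Ew; ring.
by move: Hi; rewrite -n3_pow2; congr (is_true (_ %| _)%Z); rewrite Ee ED; ring.
Qed.

Definition rep X := xchoose (class_of_surj X).
Lemma repK X : class_of (rep X) = X.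
Proof. exact/eqP/(xchooseP (class_of_surj X)). Qed.

Definition lift_act (f : triple -> triple) (X : model_point) : model_point :=
  class_of (f (rep X)).

Lemma lift_actE f : {homo f : p p' / equiv p p'} ->
  forall p, lift_act f (class_of p) = class_of (f p).
Proof.
by move=> fP p; apply/eqP; rewrite class_of_eq; apply: fP; rewrite -class_of_eq repK.
Qed.

Lemma lift_act_inj f : {mono f : p p' / equiv p p'} -> injective (lift_act f).
Proof.
move=> fP X Y /eqP; rewrite class_of_eq fP -class_of_eq !repK.
by move/eqP.
Qed.

Definition perm_a : {perm model_point} := perm (lift_act_inj equiv_a).
Definition perm_b : {perm model_point} := perm (lift_act_inj equiv_b).

Lemma perm_aE p : perm_a (class_of p) = class_of (mact_a p).
Proof. by rewrite permE lift_actE // => q q'; rewrite equiv_a. Qed.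

Lemma perm_bE p : perm_b (class_of p) = class_of (mact_b p).
Proof. by rewrite permE lift_actE // => q q'; rewrite equiv_b. Qed.

Local Open Scope group_scope.

(** Write the commutator as [(b a)^-1 (a b)] and apply [mact_ab] to a representative of the preimage
    of the point under [b a]. *)
Lemma perm_commE p : [~ perm_a, perm_b] (class_of p) = class_of (mact_c p).
Proof.
set q := rep ((perm_b * perm_a)^-1 (class_of p)).
have Eq : class_of (mact_a (mact_b q)) = class_of p.
  by rewrite -perm_aE -perm_bE -permM /q repK permKV.
have -> : [~ perm_a, perm_b] = (perm_b * perm_a)^-1 * (perm_a * perm_b).
  by rewrite commgEl conjgE invMg !mulgA.
rewrite permM -{1}(repK ((perm_b * perm_a)^-1 (class_of p))) -/q permM perm_aE perm_bE -mact_ab.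
by apply/eqP; rewrite class_of_eq; apply: equiv_c; rewrite -class_of_eq Eq.
Qed.

Lemma permX_classE (g : {perm model_point}) f n p :
  (forall q, g (class_of q) = class_of (f q)) ->
  (g ^+ n) (class_of p) = class_of (iter n f p).
Proof.
move=> gf; rewrite permX; elim: n => [|n IH] //.
by rewrite !iterS IH gf.
Qed.

Lemma perm_macdonald : macdonald x y perm_a perm_b.
Proof.
rewrite /macdonald -[[~ perm_b, perm_a]]invgR.
move: [~ perm_a, perm_b] perm_commE => c cE; split.
  apply: (mulgI c); rewrite -conjgC; apply/permP=> X.
  rewrite -(repK X) !permM perm_aE !cE (permX_classE _ _ perm_aE).
  by rewrite mact_ac.
apply: (mulIg c); rewrite conjgE invgK -!mulgA mulVg mulg1.
apply/permP=> X; rewrite -(repK X) !permM (permX_classE _ _ perm_bE) !cE perm_bE.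
by apply/eqP; rewrite class_of_eq mact_cb.
Qed.

Lemma iter_mact_c n j k : iter n mact_c (j, k, 0%N) = (j, (k + n)%N, 0%N).
Proof. by elim: n => [|n IH]; rewrite ?addn0 // iterS IH /= addnS muln0. Qed.

Lemma iter_mact_b0 n j : iter n mact_b (j, 0%N, 0%N) = ((j + n)%N, 0%N, 0%N).
Proof.
elim: n => [|n IH]; first by rewrite addn0.
by rewrite iterS IH /= stepE gsum0 muln0 expn0 addn1 addnS.
Qed.

(** The action is transitive: [b^j c^k a^i] carries the base point to the class of [(j, k, i)]. *)
Lemma card_model_dvd : (#|model_point| %| #|<<[set perm_a; perm_b]>>|)%N.
Proof.
set G := <<_>>.
have [aG bG] : perm_a \in G /\ perm_b \in G.
  by split; apply: mem_gen; rewrite !inE eqxx ?orbT.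
have cG : [~ perm_a, perm_b] \in G by rewrite groupR.
suff -> : #|model_point| = #|orbit 'P G (class_of (0, 0, 0)%N)| by apply: dvdn_orbit.
rewrite -cardsT; apply: eq_card => X; rewrite inE; symmetry; apply/orbitP.
have [[[j k] i] /eqP <-] := class_of_surj X.
exists (perm_b ^+ j * [~ perm_a, perm_b] ^+ k * perm_a ^+ i).
  by rewrite !groupM ?groupX.
move: [~ perm_a, perm_b] perm_commE => c cE.
rewrite -[LHS]/(aperm _ _) apermE permM permM (permX_classE _ _ perm_bE) iter_mact_b0.
rewrite (permX_classE _ _ cE) iter_mact_c.
by rewrite (permX_classE _ _ perm_aE) iter_mact_a.
Qed.

(** Raising a permutation to its order fixes the base point; lattice membership of the resulting
    triple then bounds the order from below. *)
Lemma order_null (g : {perm model_point}) f : (forall q, g (class_of q) = class_of (f q)) ->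
  equiv (0, 0, 0)%N (iter #[g] f (0, 0, 0)%N).
Proof.
by move=> gf; rewrite -class_of_eq -(permX_classE _ _ gf) expg_order perm1.
Qed.

Lemma order_perm_a : (n3 %| #[perm_a])%N.
Proof.
have := order_null perm_aE; rewrite iter_mact_a add0n /equiv /= !subr0.
case/and3P=> _ _; rewrite !mulr0 !addr0.
have [e1 Ee] := oddz e0_odd; have [D' ED] := D_even.
have -> : (D%:Z * w0%:Z - e0%:Z ^+ 2 = 1 + 2 * (D'%:Z * w0%:Z - 2 * e1 ^+ 2 - 2 * e1 - 1))%R.
  by rewrite Ee ED; ring.
by rewrite n3_pow2 => /pow2_gauss.
Qed.

Lemma order_perm_b : (n3 %| #[perm_b])%N.
Proof.
have := order_null perm_bE; rewrite iter_mact_b0 add0n /equiv /= !subr0.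
case/and3P=> _ _; rewrite !mulr0 !(addr0, add0r) n3_pow2.
exact: oddz_sqr_gauss d0_odd.
Qed.

Lemma order_perm_comm : (256 * K ^ 4 * D ^ 2 %| #[ [~ perm_a, perm_b] ])%N.
Proof.
have := order_null perm_commE; rewrite iter_mact_c add0n /equiv /= !subr0.
case/and3P=> _ _; rewrite !mulr0 !(addr0, add0r).
have -> : (256 * K ^ 4 * D ^ 2)%N = (2 ^ (4 * s + 2 * t + 8))%N.
  by rewrite expnD (expnD _ (4 * s)) (mulnC 4 s) (mulnC 2 t) !expnM -/K -/D; ring.
have -> : n3 = (4 * K * D * 2 ^ (4 * s + 2 * t + 8))%N.
  by rewrite expnD (expnD _ (4 * s)) (mulnC 4 s) (mulnC 2 t) !expnM -/K -/D /n3; ring.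
move=> /dvdzP[q Eq].
have := @oddz_sqr_gauss (4 * s + 2 * t + 8) d0 #[ [~ perm_a, perm_b] ] d0_odd; apply.
apply/dvdzP; exists q.
have c0 : (4 * K * D)%N%:Z != 0%R by rewrite eqz_nat -lt0n !(muln_gt0, expn_gt0).
apply: (mulfI c0); transitivity (4 * K%:Z * D%:Z * d0%:Z ^+ 2 * #[ [~ perm_a, perm_b] ]%:Z)%R.
  by ring.
by rewrite Eq; ring.
Qed.

Lemma card_model : #|model_point| = (n1 * n2 * n3)%N.
Proof. by have [? ? ?] := moduli_gt0; rewrite !card_prod !card_ord !prednK. Qed.

End Model.

Local Open Scope nat_scope.
Local Open Scope group_scope.

(** * Upper bounds for the orders of a, b and c *)

Section Zexpg.
Variable gT : finGroupType.
Implicit Types (g : gT) (z w : int).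

Lemma zexpgB g (n k : nat) : zexpg g (n%:Z - k%:Z)%R = g ^+ n * (g ^+ k)^-1.
Proof.
have [le|lt] := leqP k n.
  by rewrite subzn //= -{2}(subnK le) expgD mulgK.
have -> : (n%:Z - k%:Z)%R = Negz (k - n).-1.
  by rewrite NegzE prednK ?subn_gt0 // -subzn 1?ltnW //; ring.
by rewrite /= prednK ?subn_gt0 // -{2}(subnK (ltnW lt)) expgD invMg mulKVg.
Qed.

Lemma int_subP z : exists n k : nat, z = (n%:Z - k%:Z)%R.
Proof. by case: z => n; [exists n, 0; rewrite subr0 | exists 0, n.+1; rewrite NegzE sub0r]. Qed.

Lemma zexpgD g z w : zexpg g (z + w)%R = zexpg g z * zexpg g w.
Proof.
have [n [k ->]] := int_subP z; have [n' [k' ->]] := int_subP w.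
have -> : (n%:Z - k%:Z + (n'%:Z - k'%:Z))%R = ((n + n')%N%:Z - (k + k')%N%:Z)%R by ring.
have cg i j : commute (g ^+ i) (g ^+ j) by apply/commuteX/commute_sym/commuteX.
rewrite !zexpgB !expgD invMg -!mulgA; congr (_ * _).
have -> : (g ^+ k)^-1 * (g ^+ n' * (g ^+ k')^-1) = g ^+ n' * (g ^+ k')^-1 * (g ^+ k)^-1.
  by apply: commuteM; last apply: commuteV; apply/commute_sym/commuteV.
by rewrite !mulgA.
Qed.

Lemma zexpg0 g : zexpg g 0 = 1. Proof. by []. Qed.

Lemma zexpgN g z : zexpg g (- z)%R = (zexpg g z)^-1.
Proof. by apply/eqP; rewrite eq_sym eq_invg_mul -zexpgD subrr. Qed.

Lemma zexpg_mulz g z w : zexpg g (z * w)%R = zexpg (zexpg g z) w.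
Proof.
have posM n : zexpg g (z * n%:Z)%R = (zexpg g z) ^+ n.
  elim: n => [|n IH]; first by rewrite mulr0.
  by rewrite -addn1 PoszD mulrDr zexpgD IH mulr1 expgD.
case: w => n; first exact: posM.
by rewrite NegzE mulrN !zexpgN posM.
Qed.

Lemma zexpg1n z : zexpg (1 : gT) z = 1.
Proof. by case: z => n /=; rewrite expg1n ?invg1. Qed.

Lemma zexpg_eq1 g z : zexpg g z = 1 -> (#[g] %| `|z|)%N.
Proof.
by rewrite order_dvdn; case: z => n /= /eqP // ; rewrite invg_eq1.
Qed.

Lemma zexpg_commute g k z w : commute g k -> commute (zexpg g z) (zexpg k w).
Proof.
move=> cgk; have cz u t r : commute u t -> commute u (zexpg t r).
  by move=> cut; case: r => n; [exact: commuteX | exact/commuteV/commuteX].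
by apply/cz/commute_sym/cz/commute_sym.
Qed.

End Zexpg.

Lemma expgJ_powV (gT : finGroupType) y (b c : gT) n :
  b ^ c^-1 = b ^+ y -> (b ^+ (y ^ n)) ^ (c ^+ n) = b.
Proof. by move=> bc; rewrite -(expgJ_pow _ bc) expVgn conjgKV. Qed.

(* Compares a ^ (b^y c) with (a ^ (b^y)) ^ c: the first is (a^x)^b because
   (b^y)^c = b, and a ^ (b^y) is read off from (b^y)^a. *)
Lemma macdonald_key (gT : finGroupType) x y u w (a b : gT) :
  macdonald x y a b ->
  (x ^ x.+1 = x * gsum x x + u)%N -> (y ^ y.+1 = y * gsum y y + w)%N ->
  [~ a, b] ^+ y * (b ^+ w) ^ ([~ a, b] ^+ y.+1) * a ^+ u = [~ a, b] ^+ x.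
Proof.
move=> rel Eu Ew; have [ac] := rel; rewrite -invgR => bc.
set c := [~ a, b] in ac bc *.
have E1 : a ^ (b ^+ y * c) = c ^+ x * a ^+ (x * gsum x x).
  rewrite -(macdonald_conj x rel) -ac -conjgM; congr (_ ^ _).
  by rewrite -bc conjgE invgK -!mulgA mulVg mulg1.
have E2 : a ^ (b ^+ y) = a * (b ^+ (y * gsum y y))^-1 * c ^+ y * b ^+ y.
  have := macdonald_conj y (macdonald_sym rel); rewrite -invgR -/c expVgn => E.
  rewrite conjgE.
  have -> : b ^+ y = a * ((c ^+ y)^-1 * b ^+ (y * gsum y y)) * a^-1.
    by rewrite -E conjgE !mulgA mulgV mul1g mulgK.
  by rewrite !invMg !invgK !mulgA !mulgKV.
clearbody c.
have E3 : (b ^+ y) ^ c = b by have := expgJ_powV 1 bc; rewrite expn1.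
have E4 : (b ^+ (y ^ y.+1)) ^ (c ^+ y.+1) = b by apply: expgJ_powV.
have E5 : (a ^+ x) ^ (c ^+ x) = a ^+ (x ^ x.+1).
  by rewrite conjXg (expgJ_pow _ ac) -expgM -expnSr.
have E6 : ((b ^+ (y * gsum y y))^-1) ^ (c ^+ y.+1) = (b ^+ w) ^ (c ^+ y.+1) * b^-1.
  rewrite -[in b^-1]E4 -conjVg -conjMg; congr (_ ^ _).
  by rewrite Ew expgD invMg mulKVg.
have E7 : c ^+ y * (b ^+ w) ^ (c ^+ y.+1) = (a ^+ x)^-1 * (c ^+ x * a ^+ (x * gsum x x)).
  have := E1; rewrite conjgM E2 2!conjMg conjMg E3 ac => <-.
  rewrite -!(mulgA (a ^+ x)) mulKg.
  have -> : (c ^+ y) ^ c = c ^+ y by apply/conjg_fixP/commgP/commute_sym/commuteX.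
  by rewrite [_ ^ c * _]conjgC -conjgM -expgS E6 -!mulgA mulVg mulg1.
rewrite E7 -!mulgA -expgD -Eu -E5 -conjgC.
by rewrite mulKg.
Qed.

(** Two expressions for [a^u b] are compared: [b^(t+1) a^u] by hypothesis, and [b c^u a^(u+g)] by
    [macdonald_conj]. *)
Lemma macdonald_twist (gT : finGroupType) x y u t g (a b : gT) :
  macdonald x y a b -> (b ^+ t.+1) ^ (a ^+ u) = b -> (x * gsum x u = u + g)%N ->
  [~ a, b] ^+ u * a ^+ g = b ^+ t.
Proof.
move=> rel bt Eg; have := macdonald_conj u rel; rewrite Eg => Ec.
have E : b ^+ t.+1 * a ^+ u = a ^+ u * b by rewrite conjgC bt.
have : b * ([~ a, b] ^+ u * a ^+ (u + g)) = b ^+ t.+1 * a ^+ u.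
  by rewrite -Ec -conjgC.
by rewrite addnC expgD expgS -!mulgA => /mulgI; rewrite mulgA => /mulIg.
Qed.

(** * 2-adic expansions of the exponents *)

Section Exponents.
Local Open Scope ring_scope.
Variables (v d0 : nat).
Hypotheses (v_gt1 : (1 < v)%N) (d0_odd : odd d0).
Let h := (2 ^ v)%N.
Let d := (2 * h * d0)%N.
Let x := d.+1.

Lemma odd_sqr_mod4 : exists r : int, d0%:Z ^+ 2 = 1 + 4 * r.
Proof.
exists ((d0./2)%:Z ^+ 2 + (d0./2)%:Z).
have := odd_double_half d0; rewrite d0_odd => E.
have -> : d0%:Z = 1 + 2 * (d0./2)%:Z by lia.
by ring.
Qed.

(** Using ['C(x.+1, 2) = x * (h * d0 + 1)], the leading term of the difference is [d * x * (d - h *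
    d0) = 2 * h ^ 2 * d0 ^ 2 * x], and [d0 ^ 2 * x] is 1 modulo 4. *)
Lemma key_exponent : exists u : nat, (x ^ x.+1 = x * gsum x x + 2 * h ^ 2 * u)%N
  /\ exists r : int, u%:Z = 1 + 4 * r.
Proof.
have [q1 E1] := expn_binomial3 d x.
have [q2 E2] := mul_gsum_binomial3 d x.
have [q3 E3] := bin3_shift v 2 d0.
have [r0 Er] := odd_sqr_mod4.
have Cx : 'C(x, 2) = (h * d0 * x)%N.
  by have := bin2_double (h * d0); rewrite addn1 mulnA.
have Cx1 : 'C(x.+1, 2) = (x * (h * d0 + 1))%N by rewrite binS bin1 Cx; ring.
have Cx3 : 'C(x.+1, 3) = (h * q3)%N by rewrite -[RHS]E3; congr 'C(_, _).
rewrite -/x Cx in E1; rewrite -/x Cx1 Cx3 in E2.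
have hv : h = (4 * 2 ^ (v - 2))%N by rewrite /h -(expnD 2 2) subnKC.
set R := x%:Z ^+ 2 * d0%:Z ^+ 3 + 2 * x%:Z * d0%:Z ^+ 3 * q1%:Z - d0%:Z ^+ 2 * q3%:Z
  - 2 * d0%:Z ^+ 3 * q2%:Z.
have Eu : (x ^ x.+1)%N%:Z - (x * gsum x x)%N%:Z
   = (2 * h ^ 2)%N%:Z * (d0%:Z ^+ 2 * x%:Z + 2 * h%:Z * R).
  by rewrite E2 expnS E1 /R /x /d; ring.
have le : (x * gsum x x <= x ^ x.+1)%N.
  rewrite expnS leq_mul2l; apply/orP; right.
  have dgt0 : (0 < d)%N by rewrite /d !muln_gt0 expn_gt0 (odd_gt0 d0_odd).
  by rewrite (expn_gsum d) (leq_trans (leq_pmull _ dgt0)) // leq_addl.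
have [U EU] : exists U, d0%:Z ^+ 2 * x%:Z + 2 * h%:Z * R = U by eexists.
rewrite EU in Eu; have h0 : (0 < 2 * h ^ 2)%N by rewrite !(muln_gt0, expn_gt0).
case: U EU Eu => u EU Eu.
  exists u; split.
    by apply/eqP; rewrite -eqz_nat PoszD (PoszM (2 * h ^ 2)%N) -Eu addrC subrK.
  exists (r0 + 2 * (2 ^ (v - 2))%N%:Z * (d0%:Z ^+ 3 + R)).
  rewrite -EU; transitivity (d0%:Z ^+ 2 + 2 * h%:Z * (d0%:Z ^+ 3 + R)).
    by rewrite /x /d; ring.
  by rewrite Er hv; ring.
move: le Eu h0; move: (x ^ x.+1)%N (x * gsum x x)%N (2 * h ^ 2)%N => A B C.
rewrite NegzE mulrN -PoszM => le Eu h0; have : (0 < C * u.+1)%N by rewrite muln_gt0 h0.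
by move: Eu le; move: (C * u.+1)%N => P; clear; lia.
Qed.

Lemma twist_exponent n : exists g : nat, (x * gsum x (2 * h ^ 2 * n) =
  2 * h ^ 2 * n + 2 * h ^ 3 * g)%N /\ (odd n -> odd g).
Proof.
have [q2 E2] := mul_gsum_binomial3 d (2 * h ^ 2 * n).
have [q3 E3] := bin3_shift v 1 (h * n).
have C2 : 'C((2 * h ^ 2 * n).+1, 2) = (h ^ 2 * n * (2 * h ^ 2 * n + 1))%N.
  by have := bin2_double (h ^ 2 * n); rewrite (mulnA 2) !addn1.
have C3 : 'C((2 * h ^ 2 * n).+1, 3) = (h * q3)%N.
  by rewrite -[RHS]E3 -/h -add1n; congr ('C(_, _)); ring.
exists (d0 * n * (2 * h ^ 2 * n + 1) + 2 * d0 ^ 2 * q3 + 4 * d0 ^ 3 * q2)%N; split.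
  by rewrite E2 C2 C3 /d; ring.
by move=> on; rewrite !(oddD, oddM) d0_odd on.
Qed.

Lemma power_exponent L N : (L %| h ^ 2)%N ->
  exists g : nat, (x ^ (L * N) = 1 + 2 * h * L * g)%N
   /\ exists r : int, g%:Z = d0%:Z * N%:Z + 4 * r.
Proof.
move=> /dvdnP[j Ej].
have [q E] := gsum_binomial2 d (L * N).
have EC : (2 * 'C(L * N, 2) = L * N * (L * N).-1)%N by rewrite -mul_bin_diag bin1.
have hv : h = (4 * 2 ^ (v - 2))%N by rewrite /h -(expnD 2 2) subnKC.
exists (d0 * N + 4 * (2 ^ (v - 2) * d0 ^ 2 * N * (L * N).-1 + j * d0 ^ 3 * q))%N; split.
  rewrite (expn_gsum d) E.
  (* Pairing a 2 with the binomial turns it into a multiple of [L], and the last term is one because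
     [L] divides [h ^ 2]; both then carry an additional factor 4. *)
  have -> : (1 + d * (L * N + d * 'C(L * N, 2) + d ^ 2 * q) =
    1 + d * L * N + 2 * h * h * d0 ^ 2 * (2 * 'C(L * N, 2)) + 8 * h * h ^ 2 * d0 ^ 3 * q)%N.
    by rewrite /d; ring.
  rewrite EC Ej (_ : 4 * _ = h * (d0 ^ 2 * N * (L * N).-1) + 4 * (j * d0 ^ 3 * q))%N.
    by rewrite /d; ring.
  by rewrite hv; ring.
by exists (2 ^ (v - 2) * d0 ^ 2 * N * (L * N).-1 + j * d0 ^ 3 * q)%N%:Z; ring.
Qed.

End Exponents.

Lemma odd_root (gT : finGroupType) (g : gT) n : 2.-elt g -> odd n -> g \in <[g ^+ n]>.
Proof.
move=> pg on; have /eqP <- : generator <[g]> (g ^+ n); last exact: cycle_id.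
rewrite generator_coprime; apply: (@pnat_coprime 2); first exact: pg.
by rewrite p'natE // dvdn2 negbK.
Qed.

Lemma odd_mod4 (n : nat) (z r : int) : (n%:Z = z + 4 * r)%R -> (exists k, z = 1 + 2 * k)%R -> odd n.
Proof. by move=> En [k Ez]; have := odd_double_half n; lia. Qed.

Section Half.

Variables (gT : finGroupType) (a b : gT) (s t d0 e0 w0 : nat).
Hypotheses (d0_odd : odd d0) (e0_odd : odd e0) (w0_odd : odd w0).
Let K := (2 ^ s)%N.
Let D := (2 ^ t)%N.
Let h := (2 ^ (2 * s + t + 3))%N.
Let n1 := (32 * K ^ 3 * D ^ 2)%N.
Let d := (2 * h * d0)%N.
Let e := (2 * h * e0)%N.
Hypothesis de : (d = e + n1 * w0)%N.
Hypothesis rel : macdonald d.+1 e.+1 a b.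
Hypothesis pb : 2.-elt b.
Let c := [~ a, b].

(** These relations are used for [(a, b)] and again for [(b, a)]. The residues modulo 4 are recorded
    because a determinant formed from them must be shown to be 2 modulo 4. *)
Lemma macdonald_half : exists u w g z : nat,
  [/\ exists r : int, (u%:Z = 1 + 4 * r)%R, exists r : int, (w%:Z = 1 + 4 * r)%R,
      exists r : int, (g%:Z = e0%:Z * w0%:Z + 4 * r)%R & odd z] /\
  [/\ c ^+ (n1 * w0) = b ^+ (2 * h ^ 2 * w) * a ^+ (2 * h ^ 2 * u),
      (b ^+ (2 * h * n1 * g).+1) ^ (a ^+ (2 * h ^ 2 * u)) = b,
      c ^+ (2 * h ^ 2 * u) * a ^+ (2 * h ^ 3 * z) = b ^+ (2 * h * n1 * g) &
      b ^+ (4 * h ^ 2 * n1) \in <[a ^+ (4 * h ^ 4)]>].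
Proof.
have [ac] := rel; rewrite -invgR -/c => bc.
have v1 : (1 < 2 * s + t + 3)%N by rewrite addn3.
have hE : h = (8 * K ^ 2 * D)%N by rewrite /h expnD (expnD _ (2 * s)) (mulnC 2 s) expnM; ring.
have [u [Eu [ru Hu]]] := key_exponent v1 d0_odd.
have [w [Ew [rw Hw]]] := key_exponent v1 e0_odd.
have [z [Ez oz]] := twist_exponent (2 * s + t + 3) d0_odd u.
have n1h : (n1 %| h ^ 2)%N by rewrite hE; apply/dvdnP; exists (2 * K)%N; rewrite /n1; ring.
have [g [Eg [rg Hg]]] := power_exponent e0 v1 w0 n1h.
rewrite -/h -/d -/e in Eu Ew Ez Eg n1h.
have ou : odd u by apply: odd_mod4 Hu _; exists 0%R.
(* [n] is minus [e.+2] modulo [#[c]]: the relation describes conjugation of [b] by [c^-1], so a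
   positive power of [c] is rewritten as a power of [c^-1]. *)
set n := (#[c].-1 * e.+2)%N.
have [rn Hn] : exists r : int, ((e.+1 ^ n)%N%:Z = 1 + 4 * r)%R.
  rewrite expn_gsum; exists (4 * K%:Z ^+ 2 * D%:Z * e0%:Z * (gsum e.+1 n)%:Z)%R.
  by rewrite {1}/e hE; ring.
have cn : c ^+ e.+2 = c^-1 ^+ n.
  apply/eqP; rewrite eq_sym expVgn eq_invg_mul -expgD -mulSnr prednK ?order_gt0 //.
  by rewrite expgM expg_order expg1n.
have Ekey : c ^+ (n1 * w0) = b ^+ (2 * h ^ 2 * (w * e.+1 ^ n)) * a ^+ (2 * h ^ 2 * u).
  have := macdonald_key rel Eu Ew; rewrite -/c de -addSn expgD -mulgA => /mulgI <-.
  by congr (_ * _); rewrite cn conjXg (expgJ_pow n bc) -expgM; congr (_ ^+ _); ring.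
(* By [Ekey] this power of [a] is a power of [b] times [c ^+ (n1 * w0)], and only the latter moves
   [b]. *)
have Etw : (b ^+ (2 * h * n1 * g).+1) ^ (a ^+ (2 * h ^ 2 * u)) = b.
  have -> : a ^+ (2 * h ^ 2 * u) = (b ^+ (2 * h ^ 2 * (w * e.+1 ^ n)))^-1 * c ^+ (n1 * w0).
    by rewrite Ekey mulKg.
  rewrite conjgM (_ : _ ^ _^-1 = b ^+ (2 * h * n1 * g).+1); last first.
    apply/conjg_fixP/commgP/commuteV/commuteX/commute_sym/commuteX.
    exact: commute_refl.
  by rewrite -add1n -Eg; apply: expgJ_powV.
have Er1 := macdonald_twist rel Etw Ez.
exists u, (w * e.+1 ^ n)%N, g, z; split; split=> //.
- by exists ru.
- exists (rw + rn + 4 * rw * rn)%R; rewrite PoszM Hw Hn; ring.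
- by exists rg.
- exact: oz.
have og : odd (g * e0).
  rewrite oddM e0_odd andbT; apply: odd_mod4 Hg _.
  exists ((e0 * w0)./2%:Z)%R; have := odd_double_half (e0 * w0).
  by rewrite oddM e0_odd w0_odd -PoszM; move: (e0 * w0)%N => N; clear; lia.
have pbX : 2.-elt (b ^+ (4 * h ^ 2 * n1)) by apply: mem_p_elt (mem_cycle _ _).
have := odd_root pbX og; rewrite -expgM; apply/subsetP; rewrite cycle_subG.
(* Conjugating [Er1] by [c] fixes the power of [c] and multiplies [A] by [A ^+ d], so
   [B ^ c = B * A ^+ d]; on the other hand [(B ^ c) ^+ e.+1 = B]. Hence [B ^+ e] is a power of
   [A ^+ d]. *)
set B := b ^+ (2 * h * n1 * g) in Er1; set A := a ^+ (2 * h ^ 3 * z) in Er1.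
have EB : (B ^ c) ^+ e.+1 = B.
  by rewrite -conjXg -expgM mulnC expgM conjXg; congr (_ ^+ _); have := expgJ_powV 1 bc; rewrite expn1.
have EA : A ^+ d = ((B ^ c) ^+ e)^-1.
  have EAc : A ^ c = A * A ^+ d by rewrite -expgS conjXg ac -!expgM mulnC.
  have EBc : B ^ c = B * A ^+ d.
    rewrite -{1}Er1 conjMg EAc mulgA -Er1; congr (_ * _ * _).
    by apply/conjg_fixP/commgP/commute_sym/commuteX.
  apply: (mulgI B); rewrite -EBc -{2}EB expgS mulgK //.
have -> : b ^+ (4 * h ^ 2 * n1 * (g * e0)) = ((B ^ c) ^+ e) ^+ e.+1.
  by rewrite -[RHS]expgM (mulnC e) expgM EB -expgM; congr (_ ^+ _); rewrite /e; ring.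
rewrite groupX // -groupV -EA /A -!expgM.
have -> : (2 * h ^ 3 * z * d = 4 * h ^ 4 * (z * d0))%N by rewrite /d; ring.
by rewrite expgM mem_cycle.
Qed.

End Half.

Lemma in_cycle_sqr (gT : finGroupType) (g : gT) : 2.-elt g -> g \in <[g ^+ 2]> -> g = 1.
Proof.
move=> pg gg; have : generator <[g]> (g ^+ 2).
  by rewrite /generator eqEsubset !cycle_subG mem_cycle gg.
rewrite generator_coprime coprimen2 => og.
apply/eqP; rewrite -order_eq1; have /p_natP[[|k] Ek] := pg; first by rewrite Ek.
by rewrite Ek oddX in og.
Qed.

Lemma mutual_cycle1 (gT : finGroupType) (f g : gT) k : 2.-elt g ->
  g \in <[f ^+ (2 * k)]> -> f \in <[g ^+ (2 * k)]> -> g = 1.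
Proof.
move=> pg /cycleP[i Ei] /cycleP[j Ej]; apply: in_cycle_sqr => //.
by rewrite {1}Ei Ej -!expgM -mulnA -mulnA expgM mem_cycle.
Qed.

Lemma pelt_expg2_odd (gT : finGroupType) (g : gT) (n : nat) (z r : int) : 2.-elt g ->
  zexpg g (n%:Z * z)%R = 1 -> (z = 2 + 4 * r)%R -> g ^+ (2 * n) = 1.
Proof.
move=> pg gz Ez; have := zexpg_eq1 gz; rewrite abszM absz_nat.
have -> : `|z|%N = (2 * `|(1 + 2 * r)%R|)%N by rewrite Ez; lia.
rewrite mulnA Gauss_dvdl; first by rewrite order_dvdn mulnC => /eqP.
apply: (@pnat_coprime 2); first exact: pg.
rewrite p'natE // dvdn2 negbK; lia.
Qed.

(** * Solving the two symmetric systems *)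

Section Bounds.

Variables (gT : finGroupType) (a b : gT) (s t d0 e0 w0 : nat).
Hypotheses (t_gt1 : (1 < t)%N) (e0_odd : odd e0) (w0_odd : odd w0).
Let K := (2 ^ s)%N.
Let D := (2 ^ t)%N.
Hypothesis d0E : d0 = (e0 + 2 * K * D * w0)%N.
Let h := (2 ^ (2 * s + t + 3))%N.
Let n1 := (32 * K ^ 3 * D ^ 2)%N.
Let d := (2 * h * d0)%N.
Let e := (2 * h * e0)%N.
Hypothesis rel : macdonald d.+1 e.+1 a b.
Let c := [~ a, b].
Hypotheses (pa : 2.-elt a) (pb : 2.-elt b) (pc : 2.-elt c).

Lemma macdonald_bounds :
  [/\ a ^+ (1024 * K ^ 5 * D ^ 3) = 1, b ^+ (1024 * K ^ 5 * D ^ 3) = 1,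
      c ^+ (256 * K ^ 4 * D ^ 2) = 1,
      c ^+ (128 * K ^ 4 * D ^ 2) \in <[b ^+ (512 * K ^ 5 * D ^ 3)]> &
      exists u w, odd u /\
        c ^+ (n1 * w0) = b ^+ (128 * K ^ 4 * D ^ 2 * w) * a ^+ (128 * K ^ 4 * D ^ 2 * u)].
Proof.
have [D' ED] : exists D', D = (4 * D')%N.
  by exists (2 ^ (t - 2))%N; rewrite /D -(expnD 2 2) subnKC.
have hE : h = (8 * K ^ 2 * D)%N by rewrite /h expnD (expnD _ (2 * s)) (mulnC 2 s) expnM; ring.
have d0_odd : odd d0 by rewrite d0E oddD e0_odd -!mulnA oddM.
have de : (d = e + n1 * w0)%N by rewrite /d /e /n1 d0E hE; ring.
have [u [w [g [z [[Hu Hw Hg oz] [Key Tw R1 Pb]]]]]] := macdonald_half d0_odd e0_odd w0_odd de rel pb.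
(* The half relations require x >= y.  To apply them to (b, a), replace y by a
   larger number congruent to it modulo #[b]. *)
pose w0' := (w0 * (8 * h * #[b]).-1)%N.
pose e0' := (e0 + 4 * n1 * #[b] * w0)%N.
have n0 : (0 < 8 * h * #[b])%N by rewrite !muln_gt0 expn_gt0 order_gt0.
have e0'_odd : odd e0' by rewrite /e0' oddD e0_odd -!mulnA oddM.
have w0'_odd : odd w0'.
  rewrite /w0' oddM w0_odd /=; have : odd (8 * h * #[b]) = false by rewrite -mulnA oddM.
  by rewrite -(prednK n0) /= => /negbFE.
have ed : (2 * h * e0' = d + n1 * w0')%N.
  have : (w0' + w0 = w0 * (8 * h * #[b]))%N by rewrite /w0' -mulnSr prednK.
  move=> E; apply/eqP; rewrite -(eqn_add2r (n1 * w0)) -addnA -mulnDr E de.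
  by apply/eqP; rewrite /e0' /e; ring.
have relV : macdonald (2 * h * e0').+1 d.+1 b a.
  split; last by case: rel.
  have [_ ->] := rel; apply/eqP; rewrite eq_expg_mod_order /e0' mulnDr -addSn.
  by rewrite (_ : (2 * h * (4 * n1 * #[b] * w0) = 8 * h * n1 * w0 * #[b])%N) ?[(_ + _ * #[b])%N]addnC ?modnMDl //; ring.
have [u' [w' [g' [z' [[Hu' _ Hg' oz'] [_ Tw' R2 Pa]]]]]] :=
  macdonald_half e0'_odd d0_odd w0'_odd ed relV pa.
rewrite -invgR -/c -/h -/n1 in R2; rewrite -/h -/n1 in Pa Tw' Tw.
(* With this factorisation [Pa] and [Pb] make each [4 * h ^ 2 * n1]-th power a power of an even
   power of the other, so both are trivial. *)
have EN : (4 * h ^ 4 = 4 * h ^ 2 * n1 * (2 * K))%N by rewrite hE /n1; ring.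
rewrite EN !(expgM _ (4 * h ^ 2 * n1)) in Pa Pb.
have bN : b ^+ (4 * h ^ 2 * n1) = 1.
  by apply: mutual_cycle1 Pb Pa; apply: mem_p_elt (mem_cycle _ _).
have aN : a ^+ (4 * h ^ 2 * n1) = 1.
  by apply: mutual_cycle1 Pa Pb; apply: mem_p_elt (mem_cycle _ _).
have ou : odd u by case: Hu => r Er; apply: odd_mod4 Er _; exists 0%R.
set Q := (128 * K ^ 4 * D ^ 2)%N.
have hQ : (2 * h ^ 2 = Q)%N by rewrite hE /Q; ring.
rewrite hQ in Key Tw R1 R2.
set X := a ^+ Q; set Y := b ^+ Q.
have cXY : commute X Y.
  (* [Tw] sends [b ^+ T.+1] to [b] for [T = 2 * h * n1 * g]; on [b ^+ (2 * h)] this twist is trivial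
     by [bN]. *)
  have H1 : commute (a ^+ (Q * u)) (b ^+ (2 * h)).
    apply: commute_of_conj; rewrite -[in RHS]Tw -conjXg -!expgM.
    have -> : ((2 * h * n1 * g).+1 * (2 * h) = 4 * h ^ 2 * n1 * g + 2 * h)%N by ring.
    by rewrite expgD expgM bN expg1n mul1g.
  have H2 : commute (a ^+ (Q * u)) Y.
    have -> : Y = (b ^+ (2 * h)) ^+ h by rewrite /Y -hQ -expgM; congr (_ ^+ _); ring.
    exact: commuteX.
  have /cycleP[i Ei] : X \in <[X ^+ u]>.
    by apply: odd_root => //; apply: mem_p_elt (mem_cycle _ _).
  rewrite Ei (_ : X ^+ u = a ^+ (Q * u)); last by rewrite /X -expgM.
  exact/commute_sym/commuteX/commute_sym.
set xi := X ^+ (4 * K); set eta := Y ^+ (4 * K).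
have cxe : commute xi eta by apply/commuteX/commute_sym/commuteX/commute_sym.
have Kc i : c ^+ (Q * i * w0) = zexpg eta (w * i)%N * zexpg xi (u * i)%N.
  have -> : (Q * i * w0 = n1 * w0 * (4 * K * i))%N by rewrite /Q /n1; ring.
  rewrite expgM Key !(expgM _ Q) -/X -/Y expgMn; last first.
    by apply/commuteX/commute_sym/commuteX.
  by rewrite /= /eta /xi -!expgM; congr (_ ^+ _ * _ ^+ _); ring.
have hx i : (2 * h ^ 3 * i = Q * (4 * K * (2 * K * D * i)))%N by rewrite hE /Q; ring.
have he i : (2 * h * n1 * i = Q * (4 * K * (D * i)))%N by rewrite /n1 hE /Q; ring.
have R1' : c ^+ (Q * u) = zexpg eta (D * g)%N * zexpg xi (- (2 * K * D * z)%N%:Z)%R.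
  have : c ^+ (Q * u) * xi ^+ (2 * K * D * z) = eta ^+ (D * g).
    by rewrite /xi /eta /X /Y -!expgM -hx -he.
  by rewrite zexpgN /= => <-; rewrite mulgK.
have R2' : c ^+ (Q * u') = zexpg eta (2 * K * D * z')%N * zexpg xi (- (D * g')%N%:Z)%R.
  have : (c ^+ (Q * u'))^-1 * eta ^+ (2 * K * D * z') = xi ^+ (D * g').
    by rewrite -expVgn /xi /eta /X /Y -!expgM -hx -he.
  by rewrite zexpgN /= => <-; rewrite invMg invgK mulgA mulgV mul1g.
(* From here on the relations are vectors in the kernel of the homomorphism [phi] from pairs of
   integers to the abelian group generated by [xi] and [eta]. *)
pose phi (r1 r2 : int) := zexpg xi r1 * zexpg eta r2.
have phiD r1 r2 q1 q2 : phi (r1 + q1)%R (r2 + q2)%R = phi r1 r2 * phi q1 q2.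
  rewrite /phi !zexpgD -!mulgA; congr (_ * _); rewrite !mulgA; congr (_ * _).
  exact: zexpg_commute.
have phiX r1 r2 q : phi (r1 * q)%R (r2 * q)%R = zexpg (phi r1 r2) q.
  have posM n : phi (r1 * n%:Z)%R (r2 * n%:Z)%R = (phi r1 r2) ^+ n.
    elim: n => [|n IH]; first by rewrite !mulr0 /phi mulg1.
    by rewrite expgSr -IH -phiD -addn1 PoszD; congr (phi _ _); ring.
  case: q => n; first exact: posM.
  rewrite NegzE /= -posM; apply/eqP; rewrite eq_sym eq_invg_mul -phiD.
  by rewrite -!mulrDr addrN !mulr0 /phi mulg1.
have phi1 r1 r2 q1 q2 : zexpg eta r2 * zexpg xi r1 = zexpg eta q2 * zexpg xi q1 ->
    phi (r1 - q1)%R (r2 - q2)%R = 1.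
  have phiE n1' n2' : zexpg eta n2' * zexpg xi n1' = phi n1' n2'.
    exact/commute_sym/zexpg_commute.
  rewrite !phiE => E; apply: (mulIg (phi q1 q2)).
  by rewrite -phiD !subrK E mul1g.
pose p1 : int := (u%:Z * u%:Z + 2 * K%:Z * D%:Z * z%:Z * w0%:Z)%R.
pose p2 : int := (w%:Z * u%:Z - D%:Z * g%:Z * w0%:Z)%R.
have V1 : phi p1 p2 = 1.
  have := Kc u; rewrite expgM R1' expgMn; last exact/commute_sym/zexpg_commute.
  rewrite -![_ ^+ w0]/(zexpg _ w0%:Z) -!zexpg_mulz => /esym/phi1.
  by rewrite /p1 /p2; congr (phi _ _ = 1); ring.
pose r1 : int := (u%:Z * u'%:Z + D%:Z * g'%:Z * w0%:Z)%R.
pose r2 : int := (w%:Z * u'%:Z - 2 * K%:Z * D%:Z * z'%:Z * w0%:Z)%R.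
have V2 : phi r1 r2 = 1.
  have := Kc u'; rewrite expgM R2' expgMn; last exact/commute_sym/zexpg_commute.
  rewrite -![_ ^+ w0]/(zexpg _ w0%:Z) -!zexpg_mulz => /esym/phi1.
  by rewrite /r1 /r2; congr (phi _ _ = 1); ring.
(* The combination [u' * (p1, p2) - u * (r1, r2)] is [D * (o1, o2)]. Eliminating one coordinate
   between it and [(p1, p2)] kills [xi] and [eta] to [D] times a determinant. *)
pose o1 : int := (w0%:Z * (2 * K%:Z * z%:Z * u'%:Z - u%:Z * g'%:Z))%R.
pose o2 : int := (w0%:Z * (2 * K%:Z * z'%:Z * u%:Z - g%:Z * u'%:Z))%R.
have comb i j : phi (p1 * i + r1 * j)%R (p2 * i + r2 * j)%R = 1.
  by rewrite phiD !phiX V1 V2 !zexpg1n mulg1.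
have V3 : zexpg xi (D%:Z * (o2 * p1 - p2 * o1))%R = 1.
  rewrite -(comb (D%:Z * o2 - p2 * u'%:Z)%R (p2 * u%:Z)%R) /phi.
  rewrite (_ : (p2 * _ + r2 * _ = 0)%R) ?zexpg0 ?mulg1.
    by congr (zexpg _ _); rewrite /p1 /p2 /r1 /o1 /o2; ring.
  by rewrite /p2 /r2 /o2; ring.
have V4 : zexpg eta (D%:Z * (o1 * p2 - p1 * o2))%R = 1.
  rewrite -(comb (D%:Z * o1 - p1 * u'%:Z)%R (p1 * u%:Z)%R) /phi.
  rewrite (_ : (p1 * _ + r1 * _ = 0)%R) ?zexpg0 ?mul1g.
    by congr (zexpg _ _); rewrite /p1 /p2 /r2 /o1 /o2; ring.
  by rewrite /p1 /r1 /o1; ring.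
(* As 4 divides [D], [p1] and [p2] are 1 modulo 4, so the determinant is [o2 - o1] modulo 4. There
   [g] is [e0 * w0] and [g'] is its negative, while the terms in [K] cancel since [z], [z'], [u],
   [u'] are odd. *)
have [S ES] : exists S : int, (o2 * p1 - p2 * o1 = 2 + 4 * S)%R.
  have [ru Eu] := Hu; have [rw Ew] := Hw; have [ru' Eu'] := Hu'.
  have [rg Eg] := Hg; have [rg' Eg'] := Hg'.
  have oddz n : odd n -> exists k : int, (n%:Z = 1 + 2 * k)%R.
    by move=> on; exists (n./2)%:Z%R; have := odd_double_half n; rewrite on; clear; lia.
  have [zk Ez] := oddz z oz; have [zk' Ez'] := oddz z' oz'.
  have [|N EN'] := oddz (e0 * w0 * w0)%N; first by rewrite !oddM e0_odd w0_odd.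
  have [G EG] : exists G : int, (g'%:Z = - (e0%:Z * w0%:Z) + 4 * G)%R.
    exists (rg' + 2 * d0%:Z * h%:Z * #[b]%:Z * w0%:Z - 2 * K%:Z * D'%:Z * w0%:Z * w0%:Z)%R.
    rewrite Eg'; have -> : (w0'%:Z = w0%:Z * (8 * h%:Z * #[b]%:Z) - w0%:Z)%R.
      have : (w0' + w0 = w0 * (8 * h * #[b]))%N by rewrite /w0' -mulnSr prednK.
      move=> E; transitivity ((w0' + w0)%N%:Z - w0%:Z)%R; first by ring.
      by rewrite E; ring.
    by rewrite d0E ED; ring.
  pose P1 : int := (2 * ru + 4 * ru * ru + 2 * K%:Z * D'%:Z * z%:Z * w0%:Z)%R.
  pose P2 : int := (rw + ru + 4 * rw * ru - D'%:Z * g%:Z * w0%:Z)%R.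
  have -> : p1 = (1 + 4 * P1)%R by rewrite /p1 /P1 Eu ED; ring.
  have -> : p2 = (1 + 4 * P2)%R by rewrite /p2 /P2 Eu Ew ED; ring.
  pose S0 : int := (w0%:Z * (K%:Z * (zk' - zk + 2 * ((1 + 2 * zk') * ru - (1 + 2 * zk) * ru'))
    - rg * (1 + 4 * ru') - e0%:Z * w0%:Z * ru' + G * (1 + 4 * ru) - e0%:Z * w0%:Z * ru))%R.
  have E21 : (o2 - o1 = 2 + 4 * (S0 - 1 - N))%R.
    transitivity (4 * S0 - 2 * (e0 * w0 * w0)%N%:Z)%R.
      by rewrite /o1 /o2 Eu Eu' Ez Ez' Eg EG /S0; ring.
    by rewrite EN'; ring.
  exists (S0 - 1 - N + P1 * o2 - P2 * o1)%R.
  transitivity (o2 - o1 + 4 * (P1 * o2 - P2 * o1))%R; first by ring.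
  by rewrite E21; ring.
have pX k : 2.-elt (X ^+ k) by rewrite /X -expgM; apply: mem_p_elt (mem_cycle _ _).
have pY k : 2.-elt (Y ^+ k) by rewrite /Y -expgM; apply: mem_p_elt (mem_cycle _ _).
have xi1 : xi ^+ (2 * D) = 1 by apply: (pelt_expg2_odd (pX _) V3 ES).
have ES' : (o1 * p2 - p1 * o2 = 2 + 4 * (- S - 1))%R.
  transitivity (- (o2 * p1 - p2 * o1))%R; first by ring.
  by rewrite ES; ring.
have eta1 : eta ^+ (2 * D) = 1 by apply: (pelt_expg2_odd (pY _) V4 ES').
have n3E : (1024 * K ^ 5 * D ^ 3 = Q * (4 * K * (2 * D)))%N by rewrite /Q; ring.
have cQ : c ^+ (Q * u) = eta ^+ (D * g).
  rewrite R1' (_ : (- _)%R = ((2 * D)%N%:Z * (- (K * z)%N%:Z))%R); last by ring.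
  by rewrite zexpg_mulz /= xi1 zexpg1n mulg1.
have pcQ : 2.-elt (c ^+ Q) by apply: mem_p_elt (mem_cycle _ _).
have cQu : c ^+ Q \in <[(c ^+ Q) ^+ u]> by apply: odd_root.
rewrite -expgM cQ in cQu.
split.
- by rewrite n3E expgM (expgM _ (4 * K)%N) -/X -/xi.
- by rewrite n3E expgM (expgM _ (4 * K)%N) -/Y -/eta.
- have /cycleP[i Ei] := cQu.
  have -> : (256 * K ^ 4 * D ^ 2 = Q * 2)%N by rewrite /Q; ring.
  rewrite expgM Ei -2!(expgM eta) (_ : D * g * i * 2 = 2 * D * (g * i))%N; last by ring.
  by rewrite expgM eta1 expg1n.
- apply: subsetP cQu; rewrite cycle_subG /eta /Y -!expgM.
  rewrite (_ : Q * (4 * K * (D * g)) = 512 * K ^ 5 * D ^ 3 * g)%N; last by rewrite /Q; ring.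
  by rewrite expgM mem_cycle.
by exists u, w.
Qed.

End Bounds.

(** * Order of the group and nilpotency class *)

Lemma card_mul_cycle (gT : finGroupType) (H : {group gT}) (g : gT) n :
  (0 < n)%N -> g ^+ n \in H -> (#|(H * <[g]>)%g| <= #|H| * n)%N.
Proof.
move=> n0 gnH; set I := H :&: <[g]>.
have Ig : (#[g] <= n * #|I|)%N.
  have : (#[g ^+ n] <= #|I|)%N.
    by rewrite orderE subset_leq_card // subsetI !cycle_subG gnH mem_cycle.
  have : (gcdn #[g] n <= n)%N by rewrite dvdn_leq ?dvdn_gcdr.
  move=> l1 l2; rewrite -(divnK (dvdn_gcdl #[g] n)) -orderXgcd mulnC.
  exact: leq_mul.
rewrite -(leq_pmul2r (cardG_gt0 [group of I])) /= -mul_cardG -mulnA leq_mul2l.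
by rewrite -orderE Ig orbT.
Qed.

Lemma gen2_sub_closed (gT : finGroupType) (a b : gT) (W : {set gT}) : 1 \in W ->
  (forall g, g \in W -> g * a \in W) -> (forall g, g \in W -> g * b \in W) ->
  <<[set a; b]>> \subset W.
Proof.
move=> W1 Wa Wb; apply/subsetP=> _ /gen_prodgP[n [f fab ->]].
elim: n f fab => [|n IH] f fab; first by rewrite big_ord0.
rewrite big_ord_recr /=; have := fab ord_max; rewrite !inE.
by case/orP=> /eqP ->; [apply: Wa | apply: Wb]; apply: IH => i; apply: fab.
Qed.

(** The words [b^j c^k a^i] are closed under right multiplication by [a] and [b], by the same
    rewriting rules that define the permutation model. *)
Lemma macdonald_factor (gT : finGroupType) x y (a b : gT) : macdonald x y a b ->
  <<[set a; b]>> \subset <[b]> * <[ [~ a, b] ]> * <[a]>.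
Proof.
move=> rel; have [ac] := rel; rewrite -invgR; set c := [~ a, b] => bc.
apply: gen2_sub_closed.
- by rewrite -[1]mulg1 -{1}[1]mulg1 !mem_mulg ?group1.
- move=> g /mulsgP[u v uW va ->]; rewrite -mulgA mem_mulg //.
  by rewrite groupM ?cycle_id.
move=> _ /mulsgP[_ _ /mulsgP[_ _ /cycleP[j ->] /cycleP[k ->] ->] /cycleP[i ->] ->].
have E1 : a ^+ i * b = b * (c ^+ i * a ^+ (x * gsum x i)).
  by rewrite conjgC (macdonald_conj i rel).
have E2 : c ^+ k * b = b ^+ (y ^ k) * c ^+ k.
  by rewrite -(expgJ_pow k bc) expVgn conjgE invgK -!mulgA mulVg mulg1.
rewrite -!(mulgA (b ^+ j)) -(mulgA (c ^+ k)) E1 (mulgA (c ^+ k)) E2 -(mulgA (b ^+ _) (c ^+ k)).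
by rewrite (mulgA (b ^+ j)) -expgD (mulgA (c ^+ k)) -expgD mulgA !mem_mulg ?mem_cycle.
Qed.

(** As [c] normalises [<[b]>], the product of [<[b]>] and [<[c]>] is a subgroup; the key relation,
    with [u] odd, puts [a ^+ N3] in it. *)
Lemma macdonald_card_le (gT : finGroupType) x y (a b : gT) N1 N2 N3 u w r : macdonald x y a b ->
  (0 < N2)%N -> (0 < N3)%N -> b ^+ N1 = 1 -> (0 < N1)%N ->
  [~ a, b] ^+ N2 \in <[b]> -> 2.-elt a -> odd u ->
  [~ a, b] ^+ r = b ^+ w * a ^+ (N3 * u) ->
  (#|<<[set a; b]>>| <= N1 * N2 * N3)%N.
Proof.
move=> rel n2 n3 bN n1 cb pa ou key; have [_] := rel; rewrite -invgR.
set c := [~ a, b] in cb key * => bc.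
have nb : <[c]> \subset 'N(<[b]>).
  rewrite cycle_subG -groupV; apply/normP/eqP.
  by rewrite -cycleJ eqEcard cycle_subG bc mem_cycle -!orderE -bc orderJ leqnn.
have HE := norm_joinEr nb; set H := (<[b]> <*> <[c]>)%G.
have Hb : b \in H by rewrite mem_gen // inE cycle_id.
have Hc : c \in H by rewrite mem_gen // inE cycle_id orbT.
have aH : a ^+ N3 \in H.
  have : a ^+ N3 \in <[(a ^+ N3) ^+ u]>.
    by apply: odd_root => //; apply: mem_p_elt (mem_cycle _ _).
  apply/subsetP; rewrite cycle_subG -expgM.
  have -> : a ^+ (N3 * u) = (b ^+ w)^-1 * c ^+ r by rewrite key mulKg.
  by rewrite groupM ?groupV ?groupX.
have := subset_leq_card (macdonald_factor rel); rewrite -/c -HE => /leq_trans; apply.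
apply: leq_trans (card_mul_cycle n3 aH) _; rewrite leq_mul2r; apply/orP; right.
rewrite /= HE; apply: leq_trans (card_mul_cycle n2 cb) _; rewrite leq_mul2r.
by apply/orP; right; rewrite -orderE dvdn_leq // order_dvdn bN.
Qed.

(** * Upper and lower central series *)

Lemma in_ucnS (gT : finGroupType) (G : {group gT}) (a b z : gT) n :
  G :=: <<[set a; b]>> -> z \in G -> [~ z, a] \in 'Z_n(G) -> [~ z, b] \in 'Z_n(G) ->
  z \in 'Z_n.+1(G).
Proof.
move=> defG zG za zb; have nZ : G \subset 'N('Z_n(G)) by apply: ucn_norm.
have [aG bG] := gen2_mem defG.
rewrite ucnSn mem_morphpre ?(subsetP nZ) //= inE mem_quotient //=.
have -> : G / 'Z_n(G) = <<[set coset 'Z_n(G) a; coset 'Z_n(G) b]>>.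
  have sabN : [set a; b] \subset 'N('Z_n(G)) by rewrite -gen_subG -defG.
  by have := quotient_gen sabN; rewrite -defG quotientU !quotient_set1 ?(subsetP nZ).
rewrite cent_gen; apply/centP=> t; rewrite !inE => /orP[] /eqP->; apply/commgP;
  by rewrite -morphR ?(subsetP nZ) //; apply/eqP/coset_id.
Qed.

Lemma commVg_mem (gT : finGroupType) (H : {group gT}) (z b : gT) :
  z \in 'N(H) -> [~ z^-1, b] \in H -> [~ z, b] \in H.
Proof.
move=> zN; rewrite -(memJ_norm _ zN) -groupV => H1.
by congr (_ \in H): H1; rewrite !commgEl !conjgE !invMg !invgK !mulgA mulgKV.
Qed.

Lemma commXg1 (gT : finGroupType) (g : gT) k : [~ g ^+ k, g] = 1.
Proof. exact/eqP/commgP/commute_sym/commuteX. Qed.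

Section UpperCentral.

Variables (gT : finGroupType) (G : {group gT}) (a b : gT) (v d0 y : nat).
Hypothesis defG : G :=: <<[set a; b]>>.
Let h := (2 ^ v)%N.
Let d := (2 * h * d0)%N.
Let c := [~ a, b].
Hypotheses (d0_odd : odd d0) (rel : macdonald d.+1 y a b).
Hypotheses (a1 : a ^+ (2 * h ^ 3) = 1) (c1 : c ^+ (4 * h ^ 2) = 1).

Let conj_ab n g : (d.+1 * gsum d.+1 n = n + g)%N ->
  [~ a ^+ n, b] = (c ^+ n) ^ (a ^+ n) * a ^+ g.
Proof.
move=> Eg; rewrite commgEl (macdonald_conj n rel) Eg expgD conjgE.
by rewrite !mulgA.
Qed.

Lemma ucn1_expg : a ^+ (4 * h ^ 2) \in 'Z_1(G).
Proof.
have [aG bG] := gen2_mem defG; apply: (in_ucnS defG); first by rewrite groupX.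
  by rewrite commXg1 group1.
have [g [Eg _]] := twist_exponent v d0_odd 2.
rewrite -/h -/d (_ : 2 * h ^ 2 * 2 = 4 * h ^ 2)%N in Eg; last by ring.
by rewrite (conj_ab Eg) c1 conj1g mul1g expgM a1 expg1n.
Qed.

Lemma ucn2_expg : c ^+ (2 * h ^ 2) \in 'Z_1(G) -> a ^+ (2 * h ^ 2) \in 'Z_2(G).
Proof.
move=> cZ; have [aG bG] := gen2_mem defG; apply: (in_ucnS defG); first by rewrite groupX.
  by rewrite commXg1 group1.
have [g [Eg _]] := twist_exponent v d0_odd 1; rewrite -/h -/d muln1 in Eg.
rewrite (conj_ab Eg) (expgM a (2 * h ^ 3)%N) a1 expg1n mulg1 memJ_norm //.
by rewrite (subsetP (ucn_norm 1 G)) // groupX.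
Qed.

Lemma ucn3_expg : c ^+ (2 * h) \in 'Z_2(G) -> a ^+ (2 * h ^ 2) \in 'Z_2(G) ->
  a ^+ (2 * h) \in 'Z_3(G).
Proof.
move=> cZ aZ; have [aG bG] := gen2_mem defG; apply: (in_ucnS defG); first by rewrite groupX.
  by rewrite commXg1 group1.
have [q Eq] := mul_gsum_binomial3 d (2 * h).
have EC : ('C((2 * h).+1, 2) = h * (2 * h + 1))%N by rewrite -bin2_double addn1.
have Eg : (d.+1 * gsum d.+1 (2 * h) =
  2 * h + 2 * h ^ 2 * (d0 * (2 * h + 1) + 2 * d0 ^ 2 * 'C((2 * h).+1, 3) + 4 * h * d0 ^ 3 * q))%N.
  by rewrite Eq EC /d; ring.
rewrite (conj_ab Eg) groupM //; last by rewrite expgM groupX.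
by rewrite memJ_norm // (subsetP (ucn_norm 2 G)) // groupX.
Qed.

Lemma comm_expg_mem n i : a ^+ (d * gsum d.+1 n) \in 'Z_i(G) -> [~ c ^+ n, a] \in 'Z_i(G).
Proof.
have [ac _] := rel => aZ.
have -> : [~ c ^+ n, a] = (a ^ (c ^+ n))^-1 * a by rewrite commgEl !conjgE !invMg !invgK !mulgA.
by rewrite (expgJ_pow n ac) expn_gsum expgD invMg mulgKV groupV.
Qed.

Lemma gsum_2h : exists q, (d * gsum d.+1 (2 * h) = 4 * h ^ 2 * q)%N.
Proof.
have [q ->] := gsum_binomial2 d (2 * h).
by exists (d0 + d0 ^ 2 * 'C(2 * h, 2) + 2 * h * d0 ^ 3 * q)%N; rewrite /d; ring.
Qed.

End UpperCentral.

(** A ladder in the upper central series: [c^(2h^2)] is a power of the central [b^(4h^2)], so lies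
    in [Z_1]; then [a^(2h^2)] and [c^(2h)] lie in [Z_2], [a^(2h)] in [Z_3], [c] in [Z_4] and [a] in
    [Z_5], with the same for [b]. *)
Lemma class_le5 (gT : finGroupType) (G : {group gT}) (a b : gT) v d0 e0 k :
  let h := (2 ^ v)%N in let c := [~ a, b] in
  G :=: <<[set a; b]>> -> nilpotent G -> odd d0 -> odd e0 ->
  macdonald (2 * h * d0).+1 (2 * h * e0).+1 a b ->
  a ^+ (2 * h ^ 3) = 1 -> b ^+ (2 * h ^ 3) = 1 -> c ^+ (4 * h ^ 2) = 1 ->
  c ^+ (2 * h ^ 2) \in <[b ^+ (4 * h ^ 2 * k)]> ->
  (nil_class G <= 5)%N.
Proof.
move=> h c defG nilG od oe rel a1 b1 c1 cb.
have defG' : G :=: <<[set b; a]>> by rewrite setUC.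
have relV := macdonald_sym rel.
have cV n : [~ b, a] ^+ n = (c ^+ n)^-1 by rewrite -invgR expVgn.
have c1' : [~ b, a] ^+ (4 * h ^ 2) = 1 by rewrite cV c1 invg1.
have [aG bG] := gen2_mem defG; have cG : c \in G by rewrite groupR.
have nZ i g : g \in G -> g \in 'N('Z_i(G)) by apply/subsetP/ucn_norm.
have Za := ucn1_expg defG od rel a1 c1.
have Zb := ucn1_expg defG' oe relV b1 c1'.
have Zc : c ^+ (2 * h ^ 2) \in 'Z_1(G).
  by apply: subsetP cb; rewrite cycle_subG expgM groupX.
have Z2a := ucn2_expg defG od rel a1 Zc.
have Z2b : b ^+ (2 * h ^ 2) \in 'Z_2(G).
  by apply: (ucn2_expg defG' oe relV b1); rewrite cV groupV.
have comm_mem n i : a ^+ (2 * h * d0 * gsum (2 * h * d0).+1 n) \in 'Z_i(G) ->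
    b ^+ (2 * h * e0 * gsum (2 * h * e0).+1 n) \in 'Z_i(G) -> c ^+ n \in 'Z_i.+1(G).
  move=> Ha Hb; apply: (in_ucnS defG); first by rewrite groupX.
    exact: (@comm_expg_mem _ G a b v d0 _ rel n i Ha).
  apply: commVg_mem; first by rewrite nZ ?groupX.
  by rewrite -cV; apply: (@comm_expg_mem _ G b a v e0 _ relV n i Hb).
have Z2c : c ^+ (2 * h) \in 'Z_2(G).
  have [q Eq] := gsum_2h v d0; have [q' Eq'] := gsum_2h v e0.
  by apply: comm_mem; rewrite -/h ?Eq ?Eq' expgM groupX.
have Z3a := ucn3_expg defG rel Z2c Z2a.
have Z3b : b ^+ (2 * h) \in 'Z_3(G).
  by apply: (ucn3_expg defG' relV) => //; rewrite cV groupV.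
have Z4c : c \in 'Z_4(G).
  by rewrite -[c]expg1; apply: comm_mem; rewrite -mulnA expgM groupX.
have Z5a : a \in 'Z_5(G) by apply: (in_ucnS defG aG); [rewrite commgg group1 | exact: Z4c].
have Z5b : b \in 'Z_5(G).
  by apply: (in_ucnS defG bG); [rewrite -invgR groupV; exact: Z4c | rewrite commgg group1].
apply/(ucn_nil_classP 5 nilG)/eqP; rewrite eqEsubset ucn_sub {1}defG gen_subG subUset !sub1set.
by rewrite Z5a Z5b.
Qed.

(** Since [[~ c, a]^-1 = a ^+ d], [a^(2h)] lies in [L_3]. Then [[~ [~ a^(2h), b], a]] lies in [L_5];
    it is conjugate to [[~ c^(2h), a]], the inverse of a power of [a] with exponent [4 * h ^ 2]
    times an odd number, hence nontrivial. *)
Lemma class_ge5 (gT : finGroupType) (G : {group gT}) (a b : gT) v d0 y :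
  let h := (2 ^ v)%N in
  G :=: <<[set a; b]>> -> nilpotent G -> (1 < v)%N -> odd d0 ->
  macdonald (2 * h * d0).+1 y a b -> 2.-elt a -> (8 * h ^ 2 %| #[a])%N ->
  (4 < nil_class G)%N.
Proof.
move=> h defG nilG v1 od rel pa ao; rewrite ltnNge; apply/negP=> /(lcn_nil_classP 4 nilG) L5.
have [ac _] := rel; set d := (2 * h * d0)%N in rel ac; set c := [~ a, b] in ac.
have [aG bG] := gen2_mem defG.
have Lmem n u g : u \in 'L_n.+1(G) -> g \in G -> [~ u, g] \in 'L_n.+2(G).
  by move=> uL gG; rewrite lcnSn mem_commg.
have L2 : c \in 'L_2(G) by apply: Lmem => //; rewrite lcn1.
have L3 : a ^+ (2 * h) \in 'L_3(G).
  have : a ^+ (2 * h) \in <[(a ^+ (2 * h)) ^+ d0]>.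
    by apply: odd_root => //; apply: mem_p_elt (mem_cycle _ _).
  apply/subsetP; rewrite cycle_subG -expgM.
  have -> : a ^+ (2 * h * d0) = [~ c, a]^-1.
    by rewrite invgR commgEl ac expgS mulKg.
  by rewrite groupV Lmem.
have L4 := Lmem _ _ _ L3 bG; have := Lmem _ _ _ L4 aG.
have E : [~ a ^+ (2 * h), b] = (a ^+ (2 * h))^-1 * (c ^+ (2 * h) * a ^+ (d.+1 * gsum d.+1 (2 * h))).
  by rewrite commgEl (macdonald_conj _ rel).
have -> : [~ [~ a ^+ (2 * h), b], a] = [~ c ^+ (2 * h), a] ^ (a ^+ (d.+1 * gsum d.+1 (2 * h))).
  have fx i : a ^+ i ^ a = a ^+ i by apply/conjg_fixP/commgP/commute_sym/commuteX.
  rewrite E commgEl 2!conjMg conjVg !fx [in RHS]commgEl [in RHS]conjgE.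
  move: (c ^+ (2 * h) ^ a) (c ^+ (2 * h)) (a ^+ _) (a ^+ _) => C' C A N.
  by rewrite !invMg invgK !mulgA mulgK conjgE !mulgA.
rewrite L5 => /set1gP/eqP; rewrite conjg_eq1 => /eqP cm.
have : a ^+ (d * gsum d.+1 (2 * h)) = 1.
  have : [~ c ^+ (2 * h), a] = (a ^ (c ^+ (2 * h)))^-1 * a.
    by rewrite commgEl !conjgE !invMg !invgK !mulgA.
  rewrite cm (expgJ_pow _ ac) expn_gsum expgD invMg mulgKV => /esym/eqP.
  by rewrite invg_eq1 => /eqP.
move/eqP; rewrite -order_dvdn => /(dvdn_trans ao).
have hv : h = (4 * 2 ^ (v - 2))%N by rewrite /h -(expnD 2 2) subnKC.
have d4 : (4 %| d)%N by rewrite /d hv; apply/dvdnP; exists (2 * 2 ^ (v - 2) * d0)%N; ring.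
have d2 : (2 %| d)%N by apply: dvdn_trans d4.
have dv : (2 ^ v.+1 %| 2 * h)%N by rewrite expnS.
have [q ->] := gsum_lift (isT : prime 2) d2 (fun=> d4) dv.
have -> : (d * (2 * h + 2 ^ v.+2 * q) = 4 * h ^ 2 * (d0 * (1 + 2 * q)))%N.
  by rewrite !expnS -/h /d; ring.
have h0 : (0 < 4 * h ^ 2)%N by rewrite !(muln_gt0, expn_gt0).
have -> : (8 * h ^ 2 = 4 * h ^ 2 * 2)%N by ring.
by rewrite dvdn_pmul2l // dvdn2 !(oddM, oddD) od.
Qed.

(** * Integer exponents and conclusion *)

Lemma zexpg_eqmod (gT : finGroupType) (g : gT) (z w : int) :
  (#[g] %| (z - w)%R)%Z -> zexpg g z = zexpg g w.
Proof.
case/dvdzP=> q E; have -> : z = (w + #[g]%:Z * q)%R by rewrite mulrC -E; ring.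
by rewrite zexpgD zexpg_mulz /= expg_order zexpg1n mulg1.
Qed.

Lemma int_pfactor2 (z : int) n : z != 0%R -> logn 2 `|z|%N = n ->
  exists r : int, (z = (2 ^ n)%N%:Z * (1 + 2 * r))%R.
Proof.
rewrite -absz_gt0 => z0 <-; have [k ck Ek] := pfactor_coprime (isT : prime 2) z0.
move: (2 ^ logn 2 _)%N Ek => P Ek; rewrite coprime2n in ck.
have := odd_double_half k; rewrite ck -muln2; move: (k./2) => k2 /esym Eh.
have {}Eh : k = (1 + k2 * 2)%N := Eh.
case: z Ek {z0} => n' /= Ek; [exists k2%:Z%R | exists (- k2%:Z - 1)%R].
  by rewrite Ek Eh; ring.
by rewrite NegzE Ek Eh; ring.
Qed.

(* Replaces al and be by natural numbers congruent to them modulo N, keeping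
   the 2-adic data of the differences. *)
Lemma macdonald_approx (al be : int) (m l N : nat) : (0 < N)%N ->
  al != 1%R -> be != 1%R ->
  logn 2 (absz (al - 1)%R) = m -> logn 2 (absz (be - 1)%R) = m -> (3 <= m)%N ->
  logn 2 (absz (al - be)%R) = l ->
  (m < l)%N -> (l <= 2 * m - 3)%N -> (3 * m + 1 < 2 * l + 2)%N ->
  exists s t d0 e0 w0 : nat,
   [/\ m = (4 + 2 * s + t)%N, l = (5 + 3 * s + 2 * t)%N, (1 < t)%N, odd e0 & odd w0] /\
   [/\ d0 = (e0 + 2 * 2 ^ s * 2 ^ t * w0)%N,
       (N %| ((2 * 2 ^ (2 * s + t + 3) * d0).+1%:Z - al)%R)%Z &
       (N %| ((2 * 2 ^ (2 * s + t + 3) * e0).+1%:Z - be)%R)%Z].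
Proof.
move=> N0 al1 be1 la lb m3 lab ml lm ml2.
have [A EA] : exists r : int, (al - 1 = (2 ^ m)%N%:Z * (1 + 2 * r))%R.
  by apply: int_pfactor2 => //; rewrite subr_eq0.
have [B EB] : exists r : int, (be - 1 = (2 ^ m)%N%:Z * (1 + 2 * r))%R.
  by apply: int_pfactor2 => //; rewrite subr_eq0.
have [W EW] : exists r : int, (al - be = (2 ^ l)%N%:Z * (1 + 2 * r))%R.
  apply: int_pfactor2 => //; apply: contraTneq ml => E; by rewrite -lab E -leqNgt.
set s := (2 * m - 3 - l)%N; set t := (2 * l - (3 * m - 2))%N.
have Em : m = (4 + 2 * s + t)%N by rewrite /s /t; lia.
have El : l = (5 + 3 * s + 2 * t)%N by rewrite /s /t; lia.
have t1 : (1 < t)%N by rewrite /t; lia.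
set K := (2 ^ s)%N; set D := (2 ^ t)%N.
have Pm : (2 ^ m = 16 * K ^ 2 * D)%N.
  by rewrite Em expnD (expnD _ 4) (mulnC 2 s) expnM -/K -/D; ring.
have Pl : (2 ^ l = 32 * K ^ 3 * D ^ 2)%N.
  by rewrite El expnD (expnD _ 5) (mulnC 3 s) (mulnC 2 t) !expnM -/K -/D; ring.
have hE : (2 ^ (2 * s + t + 3) = 8 * K ^ 2 * D)%N.
  by rewrite expnD (expnD _ (2 * s)) (mulnC 2 s) expnM -/K -/D; ring.
clearbody s t.
have ABW : (A = B + K%:Z * D%:Z * (1 + 2 * W))%R.
  have P0 : ((2 ^ m.+1)%N%:Z != 0)%R by rewrite eqz_nat -lt0n expn_gt0.
  apply: (mulfI P0); rewrite expnS.
  transitivity (al - 1 - (2 ^ m)%N%:Z)%R; first by rewrite EA; ring.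
  transitivity (be - 1 + (al - be) - (2 ^ m)%N%:Z)%R; first by ring.
  by rewrite EB EW Pm Pl; ring.
(* Adding a large multiple of [2 * C] makes [1 + 2 * z] positive without changing its class modulo
   [2 * C]. *)
have pos (C : nat) (z : int) : (0 < C)%N -> exists2 n : nat,
    (n%:Z = 1 + 2 * z + 2 * C%:Z * (`|z|%N + 1)%N%:Z)%R & odd n.
  move=> C0; exists `|(1 + 2 * z + 2 * C%:Z * (`|z|%N + 1)%N%:Z)%R|%N.
    rewrite gez0_abs //.
    have : (`|z|%N + 1 <= C * (`|z|%N + 1))%N by rewrite leq_pmull.
    rewrite -[(2 * C%:Z * _)%R]mulrA -PoszM; move: (C * _)%N => P; clear; lia.
  have -> : (1 + 2 * z + 2 * C%:Z * (`|z|%N + 1)%N%:Z = 1 + 2 * (z + (C * (`|z|%N + 1))%N%:Z))%R.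
    by ring.
  by move: (z + _)%R => w; clear; lia.
have [w0 Ew ow] := pos N W N0.
have [|e0 Ee oe] := pos (2 * K * D * N)%N B; first by rewrite !(muln_gt0, expn_gt0).
exists s, t, (e0 + 2 * K * D * w0)%N, e0, w0; split; split=> //.
  apply/dvdzP; exists (64 * K%:Z ^+ 3 * D%:Z ^+ 2 * ((`|B|%N + 1)%N%:Z + (`|W|%N + 1)%N%:Z))%R.
  transitivity ((2 ^ m)%N%:Z * (e0%:Z + 2 * K%:Z * D%:Z * w0%:Z) - (al - 1))%R.
    by rewrite hE Pm; ring.
  by rewrite EA ABW Ew Ee Pm; ring.
apply/dvdzP; exists (64 * K%:Z ^+ 3 * D%:Z ^+ 2 * (`|B|%N + 1)%N%:Z)%R.
transitivity ((2 ^ m)%N%:Z * e0%:Z - (be - 1))%R; first by rewrite hE Pm; ring.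
by rewrite EB Ee Pm; ring.
Qed.

Lemma Grels_macdonald (gT : finGroupType) (al be : int) (x y N : nat) (a b : gT) :
  (N %| (x%:Z - al)%R)%Z -> (N %| (y%:Z - be)%R)%Z -> (#[a] %| N)%N -> (#[b] %| N)%N ->
  Grels al be a b <-> macdonald x y a b.
Proof.
move=> xal ybe aN bN; rewrite /Grels /macdonald.
have -> : zexpg a al = a ^+ x.
  rewrite -[RHS]/(zexpg a x%:Z); apply/esym/zexpg_eqmod.
  by apply: (@dvdz_trans N) => //; rewrite dvdzE.
have -> : zexpg b be = b ^+ y.
  rewrite -[RHS]/(zexpg b y%:Z); apply/esym/zexpg_eqmod.
  by apply: (@dvdz_trans N) => //; rewrite dvdzE.
by [].
Qed.

Theorem theorem16p4 (al be : int) (m l : nat) :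
  al != 1%R -> be != 1%R ->
  logn 2 (absz (al - 1)%R) = m -> logn 2 (absz (be - 1)%R) = m -> (3 <= m)%N ->
  logn 2 (absz (al - be)%R) = l ->
  (m < l)%N -> (l <= 2 * m - 3)%N -> (3 * m + 1 < 2 * l + 2)%N ->
  forall (gT : finGroupType) (G : {group gT}) (A B : gT),
    presents_G G al be A B ->
    forall P : {group gT}, P \in 'Syl_2(G) ->
      [/\ #|P| = (2 ^ (5 * m + l - 1))%N,
          nil_class P = 5%N,
          #[A.`_2] = (2 ^ (l + m + 1))%N,
          #[B.`_2] = (2 ^ (l + m + 1))%N &
          #[([~ A, B]).`_2] = (2 ^ (2 * m))%N].
Proof.
move=> al1 be1 la lb m3 lab ml lm ml2 gT G A B [defG rels univ] P sylP.
(* The modulus must serve both for gT and for the model, whose permutations only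
   exist once s and t are known. *)
pose N s t := (#|[set: gT]| * #|[set: {perm model_point s t}]|)%N.
set N0 := N (2 * m - 3 - l)%N (2 * l - (3 * m - 2))%N.
have N0_gt0 : (0 < N0)%N by rewrite muln_gt0 !cardG_gt0.
have [s [t [d0 [e0 [w0 [[Em El t1 oe ow] [d0E xal ybe]]]]]]] :=
  macdonald_approx N0_gt0 al1 be1 la lb m3 lab ml lm ml2.
have Es : (2 * m - 3 - l = s)%N by rewrite Em El; clear; lia.
have Et : (2 * l - (3 * m - 2) = t)%N by rewrite Em El; clear; lia.
rewrite /N0 Es Et in xal ybe.
set h := (2 ^ (2 * s + t + 3))%N in xal ybe.
have orderN (hT : finGroupType) (g : hT) : (#[g] %| #|[set: hT]|)%N by apply: order_dvdG; rewrite inE.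
have rel : macdonald (2 * h * d0).+1 (2 * h * e0).+1 A B.
  by apply: (iffLR (Grels_macdonald xal ybe _ _) rels); apply: dvdn_mulr.
have hE : h = (8 * (2 ^ s) ^ 2 * 2 ^ t)%N.
  by rewrite /h expnD (expnD _ (2 * s)) (mulnC 2 s) expnM; ring.
have d4 r : (4 %| 2 * h * r)%N by rewrite hE; apply/dvdnP; exists (4 * (2 ^ s) ^ 2 * 2 ^ t * r)%N; ring.
have [defP relP defC] := macdonald_sylow defG rel (d4 d0) (d4 e0) sylP.
set a := A.`_2 in defP relP defC *; set b := B.`_2 in defP relP defC *.
have od : odd d0 by rewrite d0E oddD oe -!mulnA oddM.
have t0 : (0 < t)%N by apply: ltnW.
have pP : 2.-group P by move: sylP; rewrite inE => /pHall_pgroup.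
have nilP := pgroup_nil pP.
have [aP bP] := gen2_mem defP.
have pa : 2.-elt a := mem_p_elt pP aP.
have pb : 2.-elt b := mem_p_elt pP bP.
have pc : 2.-elt [~ a, b] by apply: mem_p_elt pP _; rewrite groupR.
have [a1 b1 c1 cb [u [w [ou key]]]] := macdonald_bounds t1 oe ow d0E relP pa pb pc.
pose pA := perm_a t0 oe ow d0E; pose pB := perm_b t0 oe ow d0E.
have relM : Grels al be pA pB.
  apply: (iffRL (Grels_macdonald xal ybe _ _) (perm_macdonald t0 oe ow d0E)); exact: dvdn_mull.
(* The universal property maps [G] onto the group generated by the model permutations, so lower
   bounds transfer to [G]. *)
have [f [fA fB]] := univ _ pA pB relM.
have [AG BG] := gen2_mem defG.
have n3E : (1024 * (2 ^ s) ^ 5 * (2 ^ t) ^ 3 = 2 ^ (l + m + 1))%N.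
  have -> : (l + m + 1 = 5 * s + 3 * t + 10)%N by rewrite Em El; clear; lia.
  by rewrite expnD (expnD _ (5 * s)) (mulnC 5 s) (mulnC 3 t) !expnM; ring.
(* The relations bound the order of the 2-part from above; the model gives [n %| #[g]], and a power
   of 2 dividing [#[g]] divides the order of its 2-part. *)
have ordP (g : gT) n k : g.`_2 ^+ n = 1 -> n = (2 ^ k)%N -> (n %| #[g])%N -> #[g.`_2] = (2 ^ k)%N.
  move=> g1 En ng; apply/eqP; rewrite eqn_dvd order_dvdn -En g1 eqxx /=.
  rewrite order_constt -(part_pnat_id (_ : 2.-nat n)); last by rewrite En pnatX.
  exact: partn_dvd (order_gt0 _) ng.
have oA : (1024 * (2 ^ s) ^ 5 * (2 ^ t) ^ 3 %| #[A])%N.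
  by apply: dvdn_trans (order_perm_a t0 oe ow d0E) _; rewrite -/pA -fA; apply: morph_order.
have oB : (1024 * (2 ^ s) ^ 5 * (2 ^ t) ^ 3 %| #[B])%N.
  by apply: dvdn_trans (order_perm_b t0 oe ow d0E) _; rewrite -/pB -fB; apply: morph_order.
have oC : (256 * (2 ^ s) ^ 4 * (2 ^ t) ^ 2 %| #[ [~ A, B] ])%N.
  apply: dvdn_trans (order_perm_comm t0 oe ow d0E) _; rewrite -/pA -/pB -fA -fB.
  by rewrite -morphR //; apply: morph_order; rewrite groupR.
have oa : #[a] = (2 ^ (l + m + 1))%N := ordP _ _ _ a1 n3E oA.
split=> //.
- have XE : #|model_point s t| = (2 ^ (5 * m + l - 1))%N.
    have -> : (5 * m + l - 1 = 13 * s + 7 * t + 24)%N by rewrite Em El; clear; lia.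
    rewrite card_model expnD (expnD _ (13 * s)) (mulnC 13 s) (mulnC 7 t) !expnM.
    by move: (2 ^ s)%N (2 ^ t)%N => K D; ring.
  apply/eqP; rewrite eqn_leq; apply/andP; split; last first.
    (* Lower bound: the size of the model is a power of 2 dividing the order of [G], hence at most
       the 2-part of that order. *)
    have sylG : 2.-Sylow(G) P by move: sylP; rewrite inE.
    rewrite (card_Hall sylG) -XE -(part_pnat_id (_ : 2.-nat #|model_point s t|)); last first.
      by rewrite XE pnatX.
    apply: dvdn_leq; first exact: part_gt0.
    apply: partn_dvd; first exact: cardG_gt0.
    apply: dvdn_trans (card_model_dvd t0 oe ow d0E) _.
    rewrite -/pA -/pB -fA -fB.
    have sABG : [set A; B] \subset G by rewrite subUset !sub1set AG.
    have := morphim_gen f sABG; rewrite -defG morphimU !morphim_set1 // => <-.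
    exact: dvdn_morphim.
  have Q0 : (0 < 128 * (2 ^ s) ^ 4 * (2 ^ t) ^ 2)%N by rewrite !(muln_gt0, expn_gt0).
  have n30 : (0 < 1024 * (2 ^ s) ^ 5 * (2 ^ t) ^ 3)%N by rewrite n3E expn_gt0.
  have cb' : [~ a, b] ^+ (128 * (2 ^ s) ^ 4 * (2 ^ t) ^ 2) \in <[b]>.
    by apply: subsetP cb; rewrite cycle_subG mem_cycle.
  have := macdonald_card_le relP Q0 Q0 b1 n30 cb' pa ou key; rewrite -defP -XE card_model.
  by congr (_ <= _)%N; move: (2 ^ s)%N (2 ^ t)%N => K D; ring.
- apply/eqP; rewrite eqn_leq; apply/andP; split.
    (* The last argument makes [4 * h ^ 2 * k] equal to the exponent of [b] in [cb]. *)
    apply: (@class_le5 _ P a b (2 * s + t + 3) d0 e0 (2 * 2 ^ s * 2 ^ t)); rewrite -/h //.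
    - rewrite (_ : 2 * h ^ 3 = 1024 * (2 ^ s) ^ 5 * (2 ^ t) ^ 3 * 2 ^ s)%N; last by rewrite hE; ring.
      by rewrite expgM a1 expg1n.
    - rewrite (_ : 2 * h ^ 3 = 1024 * (2 ^ s) ^ 5 * (2 ^ t) ^ 3 * 2 ^ s)%N; last by rewrite hE; ring.
      by rewrite expgM b1 expg1n.
    - by rewrite (_ : 4 * h ^ 2 = 256 * (2 ^ s) ^ 4 * (2 ^ t) ^ 2)%N // hE; ring.
    rewrite (_ : 2 * h ^ 2 = 128 * (2 ^ s) ^ 4 * (2 ^ t) ^ 2)%N; last by rewrite hE; ring.
    rewrite (_ : 4 * h ^ 2 * _ = 512 * (2 ^ s) ^ 5 * (2 ^ t) ^ 3)%N //; last by rewrite hE; ring.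
  apply: (@class_ge5 _ P a b (2 * s + t + 3) d0 (2 * h * e0).+1); rewrite -/h //.
    by rewrite addn3.
  rewrite oa -n3E hE; apply/dvdnP; exists (2 * 2 ^ s * 2 ^ t)%N; ring.
- exact: ordP b1 n3E oB.
have n4E : (256 * (2 ^ s) ^ 4 * (2 ^ t) ^ 2 = 2 ^ (2 * m))%N.
  have -> : (2 * m = 4 * s + 2 * t + 8)%N by rewrite Em; clear; lia.
  by rewrite expnD (expnD _ (4 * s)) (mulnC 4 s) (mulnC 2 t) !expnM; ring.
by apply: ordP n4E oC; rewrite defC.
Qed.
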